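(* Let $c^n_k$, $n\ge k\ge0$, be a given set of complex numbers. The following are equivalent. (i) For every Koszul $\bullet$-bracket $\Phi_\Delta$, i.e. for every choice of $\epsilon\in\{0,1\}$, of an associative graded algebra $(\mathcal{A},\cdot)$ of suspension parity $\epsilon$, of an element $e\in\mathcal{A}$ with $\epsilon(e)=\epsilon$, and of a Grassmann-odd linear operator $\Delta:\mathcal{A}\to\mathcal{A}$, such that $\Delta$ is nilpotent in the sense that $\Delta R_e\Delta=0$ (where $R_e(b)=b\cdot e$), the nilpotency relations $\Phi_\Delta\circ\Phi_\Delta=0$ hold, where $\circ$ is the bracket product with coefficients $c^n_k$. (ii) For every $n\in\{0,1,2,\dots\}$, the number $c^n_k=c^n$ is independent of $k\in\{0,\dots,n\}$. The same equivalence holds when in (i) the class of data $(\mathcal{A},e,\Delta)$ is restricted to those for which the image of $\Delta$ lies in the center, $\mathrm{Im}(\Delta)\subseteq Z(\mathcal{A})$.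
   Context: Vector spaces are $\mathbb{Z}_2$-graded over $\mathbb{C}$; $\epsilon_a=\epsilon(a)$ is the Grassmann parity (mod 2) of a homogeneous element $a$. A graded algebra $(\mathcal{A},\cdot)$ of suspension parity $\epsilon$ is a graded vector space with a bilinear, associative product with $\epsilon(a\cdot b)=\epsilon_a+\epsilon_b+\epsilon$. No unit is assumed. Its center is $Z(\mathcal{A})=\{a\mid \forall b:\ b\cdot a=(-1)^{(\epsilon_a+\epsilon)(\epsilon_b+\epsilon)}a\cdot b\}$. Sign $(-1)^{\epsilon_{\pi,a}}$: let $\mathrm{Sym}^n_\epsilon\mathcal{A}$ be the quotient of $\mathcal{A}^{\otimes n}$ in which neighbouring factors commute as $b\odot a=(-1)^{(\epsilon_a+\epsilon)(\epsilon_b+\epsilon)}a\odot b$. Then $(-1)^{\epsilon_{\pi,a}}$ is defined by $a_{\pi(1)}\odot\dots\odot a_{\pi(n)}=(-1)^{\epsilon_{\pi,a}}a_1\odot\dots\odot a_n$. A $\bullet$-bracket $\Phi:\mathrm{Sym}^\bullet_\epsilon\mathcal{A}\to\mathcal{A}$ is a collection of linear maps $\Phi^n:\mathrm{Sym}^n_\epsilon\mathcal{A}\to\mathcal{A}$, $n\ge0$. The bracket product with coefficients $c^n_k$ of two $\bullet$-brackets is $$(\Phi\circ\Phi')^n(a_1,\dots,a_n)=\sum_{k=0}^n\frac{c^n_k}{k!(n-k)!}\sum_{\pi\in S_n}(-1)^{\epsilon_{\pi,a}}\Phi^{n-k+1}\big(\Phi'^k(a_{\pi(1)},\dots,a_{\pi(k)}),a_{\pi(k+1)},\dots,a_{\pi(n)}\big),\quad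 n\ge0.$$ Koszul brackets: define numbers $B_{k,\ell}$ by $\sum_{k,\ell\ge0}B_{k,\ell}\frac{x^k}{k!}\frac{y^\ell}{\ell!}=\frac{x-y}{e^x-e^y}$. For a Grassmann-odd linear operator $\Delta$, $$\Phi_\Delta^n(a_1,\dots,a_n)=\sum_{\substack{i,j,k\ge0\\ i+j+k=n}}\frac{B_{i,k}}{i!\,j!\,k!}\sum_{\pi\in S_n}(-1)^{\epsilon_{\pi,a}+\epsilon_{\pi(1)}+\dots+\epsilon_{\pi(i)}+i\epsilon}\,a_{\pi(1)}\cdot\ldots\cdot a_{\pi(i)}\cdot\Delta\big(a_{\pi(i+1)}\cdot\ldots\cdot a_{\pi(i+j)}\cdot e\big)\cdot a_{\pi(i+j+1)}\cdot\ldots\cdot a_{\pi(n)},$$ with $\epsilon_r=\epsilon(a_r)$ and empty products of $a$'s omitted; $\Phi_\Delta^0=\Delta(e)$. When $\mathrm{Im}(\Delta)\subseteq Z(\mathcal{A})$ this coincides with $\frac1{n!}\sum_{\pi\in S_n}(-1)^{\epsilon_{\pi,a}}[[\dots[\Delta,L_{a_{\pi(1)}}],\dots],L_{a_{\pi(n)}}]e$, where $L_a(b)=a\cdot b$ has parity $\epsilon_a+\epsilon$ and $[S,T]=ST-(-1)^{\epsilon_S\epsilon_T}TS$. *)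

(* Defs.v *)
From mathcomp Require Import all_boot all_order all_fingroup all_algebra.
From mathcomp Require Import boolp.
From mathcomp Require Import zify.

Set Implicit Arguments.
Unset Strict Implicit.
Unset Printing Implicit Defensive.

Import Order.TTheory GRing.Theory Num.Theory.
Local Open Scope ring_scope.

(* Parities live in bool: false is even, true is odd, (+) is addition and &&  *)
(* multiplication mod 2; (-1) ^+ b uses the coercion from bool to nat.        *)

(* The decomposition V = V_0 (+) V_1 is given by its two projections, so that *)
(* gpart p a is the component of a of parity p.                               *)
Record gradedSpace (K : numFieldType) := GradedSpace {
  gcarrier :> lmodType K;
  gpart : bool -> {linear gcarrier -> gcarrier};
  gpartK : forall (p q : bool) (a : gcarrier),
    gpart p (gpart q a) = if p == q then gpart q a else 0;
  gpart_sum : forall a : gcarrier, gpart false a + gpart true a = a }.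
Arguments gpart {K g} p.

Definition homogeneous (K : numFieldType) (V : gradedSpace K) (p : bool)
    (a : V) : Prop :=
  gpart p a = a.

Definition grassmann_odd (K : numFieldType) (V : gradedSpace K)
    (D : V -> V) : Prop :=
  forall (p : bool) (a : V), homogeneous p a -> homogeneous (~~ p) (D a).

Record gradedAlgebra (K : numFieldType) (eps : bool) := GradedAlgebra {
  gspace :> gradedSpace K;
  gmul : gspace -> gspace -> gspace;
  gmul_linearr : forall a : gspace, linear (gmul a);
  gmul_linearl : forall b : gspace, linear (gmul^~ b);
  gmulA : associative gmul;
  gmul_parity : forall (p q : bool) (a b : gspace),
    homogeneous p a -> homogeneous q b ->
    homogeneous (p (+) q (+) eps) (gmul a b) }.

(* The sign rule is imposed on the homogeneous components of a.               *)
Definition in_center (K : numFieldType) (eps : bool) (A : gradedAlgebra K eps)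
    (a : A) : Prop :=
  forall (p q : bool) (b : A), homogeneous q b ->
    gmul b (gpart p a)
      = (-1) ^+ ((p (+) eps) && (q (+) eps)) *: gmul (gpart p a) b.

(* Koszul sign of (a_1, ..., a_n) -> (a_pi(1), ..., a_pi(n)), where p i is    *)
(* the parity of a_i: one factor for each inversion of pi. It is determined   *)
(* by the neighbour exchange rule of Sym_eps, see koszul_signP below.         *)
Definition koszul_sign (eps : bool) (n : nat) (p : 'I_n -> bool) (pi : 'S_n) :
    bool :=
  \big[addb/false]_(i < n) \big[addb/false]_(j < n | (i < j)%N && (pi j < pi i)%N)
    ((p (pi i) (+) eps) && (p (pi j) (+) eps)).

(* The term with numerator B_{k,l} of the exponential generating series of B, *)
(* and the coefficients of e^x - e^y.                                         *)
Definition egf2 (K : numFieldType) (B : nat -> nat -> K) (k l : nat) : K :=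
  B k l / (k`! * l`!)%:R.

Definition exp_diff (K : numFieldType) (k l : nat) : K :=
  (l == 0)%:R / k`!%:R - (k == 0)%:R / l`!%:R.

Definition x_minus_y (K : numFieldType) (k l : nat) : K :=
  ((k == 1) && (l == 0))%:R - ((k == 0) && (l == 1))%:R.

Definition psmul2 (K : numFieldType) (f g : nat -> nat -> K) (m n : nat) : K :=
  \sum_(k < m.+1) \sum_(l < n.+1) f k l * g (m - k)%N (n - l)%N.

(* sum_{k,l} B_{k,l} x^k/k! y^l/l! = (x - y) / (e^x - e^y) in K[[x, y]].      *)
Definition koszul_numbers (K : numFieldType) (B : nat -> nat -> K) : Prop :=
  forall m n : nat, psmul2 (egf2 B) (@exp_diff K) m n = x_minus_y K m n.

Section KoszulNumbers.
Variable K : numFieldType.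

(* (e^x - e^y) / (x - y) *)
Let dd (m n : nat) : K := ((m + n).+1)`!%:R^-1.

Lemma exp_diffE m n :
  exp_diff K m n = (if m is m'.+1 then dd m' n else 0)
                 - (if n is n'.+1 then dd m n' else 0).
Proof.
rewrite /exp_diff /dd; case: m => [|m]; case: n => [|n] //=.
- by rewrite !subrr.
- by rewrite mul0r mul1r add0n.
- by rewrite mul0r mul1r addn0.
- by rewrite !mul0r addSnnS !subrr.
Qed.

Lemma psmul2_exp_diff (f : nat -> nat -> K) m n :
  psmul2 f (@exp_diff K) m n
  = (if m is m'.+1 then psmul2 f dd m' n else 0)
  - (if n is n'.+1 then psmul2 f dd m n' else 0).
Proof.
rewrite /psmul2.
under eq_bigr => k _.
  under eq_bigr => l _ do rewrite exp_diffE mulrBr.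
  rewrite sumrB; over.
rewrite sumrB; congr (_ - _).
- case: m => [|m].
    by rewrite big1 // => k _; rewrite big1 // => l _; rewrite sub0n mulr0.
  rewrite big_ord_recr /= subnn [X in _ + X]big1 ?addr0; last first.
    by move=> l _; rewrite mulr0.
  apply: eq_bigr => k _; apply: eq_bigr => l _.
  by rewrite subSn // -ltnS.
- case: n => [|n].
    by rewrite big1 // => k _; rewrite big1 // => l _; rewrite sub0n mulr0.
  apply: eq_bigr => k _; rewrite big_ord_recr /= subnn mulr0 addr0.
  by apply: eq_bigr => l _; rewrite subSn // -ltnS.
Qed.

Fixpoint inv_dd_rec (fuel : nat) (m n : nat) : K :=
  if fuel is t.+1 then
    ((m == 0) && (n == 0))%:R
    - \sum_(k < m.+1) \sum_(l < n.+1 | (k + l < m + n)%N)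
        inv_dd_rec t k l * dd (m - k) (n - l)
  else 0.

Let inv_dd (m n : nat) : K := inv_dd_rec (m + n).+1 m n.

Lemma inv_dd_fuel t m n : (m + n < t)%N -> inv_dd_rec t m n = inv_dd m n.
Proof.
rewrite /inv_dd; move Es: (m + n)%N => s.
elim/ltn_ind: s t m n Es => s IH [|t] m n Es lt_st //=.
congr (_ - _); apply: eq_bigr => k _; apply: eq_bigr => l lt_kl.
rewrite Es in lt_kl.
rewrite (IH _ lt_kl t) ?(IH _ lt_kl s) //.
exact: leq_trans lt_kl lt_st.
Qed.

Lemma inv_ddE m n : psmul2 inv_dd dd m n = ((m == 0) && (n == 0))%:R.
Proof.
rewrite /psmul2.
under eq_bigr => k _ do rewrite (bigID (fun l : 'I_n.+1 => (k + l < m + n)%N)) /=.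
rewrite big_split /=; set S1 := (X in X + _).
rewrite big_ord_recr /= big1 => [|k _]; last first.
  rewrite big_pred0 // => l; apply/negbTE; rewrite negbK -addSn.
  by apply: leq_add; [exact: ltn_ord | rewrite -ltnS; exact: ltn_ord].
rewrite (big_pred1 ord_max) => [|l] /=; last first.
  by rewrite ltn_add2l -leqNgt -val_eqE /= eqn_leq -[X in X && _]ltnS ltn_ord.
rewrite !subnn [dd 0 0]invr1 mulr1 add0r {1}/inv_dd /=.
set S2 := (X in _ - X).
have -> : S1 = S2.
  rewrite /S1 /S2; apply: eq_bigr => k _; apply: eq_bigr => l lt_kl.
  by rewrite (inv_dd_fuel lt_kl).
by rewrite addrC subrK.
Qed.

Lemma koszul_numbers_exist : exists B : nat -> nat -> K, koszul_numbers B.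
Proof.
exists (fun k l => inv_dd k l * (k`! * l`!)%:R) => m n.
have -> : egf2 (fun k l => inv_dd k l * (k`! * l`!)%:R) = inv_dd.
  apply/funext => k; apply/funext => l; rewrite /egf2 mulfK //.
  by rewrite pnatr_eq0 -lt0n muln_gt0 !fact_gt0.
rewrite psmul2_exp_diff /x_minus_y.
by case: m n => [|m] [|n]; rewrite ?inv_ddE ?eqSS ?andbF ?andbT //=.
Qed.

Lemma koszul_numbers_unique (B B' : nat -> nat -> K) :
  koszul_numbers B -> koszul_numbers B' -> B = B'.
Proof.
move=> BP B'P.
pose F := egf2 B; pose F' := egf2 B'.
have eqE m n : psmul2 F (@exp_diff K) m n = psmul2 F' (@exp_diff K) m n.
  by rewrite BP B'P.
have eqD : forall m n, psmul2 F dd m n = psmul2 F' dd m n.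
  elim=> [|m IH] n.
    by have := eqE 0 n.+1; rewrite !psmul2_exp_diff !sub0r => /oppr_inj.
  have := eqE m.+1 n.+1; rewrite !psmul2_exp_diff IH.
  by move/addrI/oppr_inj.
have eqF s : forall m n, (m + n < s)%N -> F m n = F' m n.
  elim: s => // s IH m n; rewrite ltnS => le_mn.
  have := eqD m n; rewrite /psmul2.
  rewrite big_ord_recr [RHS]big_ord_recr /= big_ord_recr [X in _ = _ + X]big_ord_recr /=.
  rewrite !subnn /dd /= divr1 divr1 !addrA.
  have -> : \sum_(k < m) \sum_(l < n.+1) F k l * ((m - k + (n - l)).+1)`!%:R^-1
    = \sum_(k < m) \sum_(l < n.+1) F' k l * ((m - k + (n - l)).+1)`!%:R^-1.
    apply: eq_bigr => k _; apply: eq_bigr => l _; rewrite IH //.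
    apply: leq_trans le_mn; rewrite -addSn; apply: leq_add => //.
    by rewrite -ltnS.
  have -> : \sum_(l < n) F m l * ((0 + (n - l)).+1)`!%:R^-1
    = \sum_(l < n) F' m l * ((0 + (n - l)).+1)`!%:R^-1.
    apply: eq_bigr => l _; rewrite IH //.
    by apply: leq_trans le_mn; rewrite -addnS leq_add2l.
  by move/addrI.
apply/funext => k; apply/funext => l.
have := eqF (k + l).+1 k l (ltnSn _); rewrite /F /F' /egf2.
apply: mulIf; rewrite invr_eq0.
by rewrite pnatr_eq0 -lt0n muln_gt0 !fact_gt0.
Qed.

End KoszulNumbers.

Definition koszulB (K : numFieldType) : nat -> nat -> K :=
  sval (cid (koszul_numbers_exist K)).

Lemma koszulBP (K : numFieldType) : koszul_numbers (koszulB K).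
Proof. exact: svalP (cid (koszul_numbers_exist K)). Qed.

Section KoszulSign.
Variables (eps : bool) (n : nat) (p : 'I_n -> bool).

Lemma koszul_sign_id : koszul_sign eps p 1%g = false.
Proof.
rewrite /koszul_sign big1 // => i _; rewrite big_pred0 // => j.
by rewrite !perm1 andbC ltnNge; case: ltngtP.
Qed.

Lemma koszul_sign_exchange (pi : 'S_n) (i j : 'I_n) : j = i.+1 :> nat ->
  koszul_sign eps p (tperm i j * pi)%g
    = koszul_sign eps p pi
      (+) ((p (pi i) (+) eps) && (p (pi j) (+) eps)).
Proof.
move=> Ej; pose G (x : 'I_n * 'I_n) := (pi x.2 < pi x.1)%N &&
  ((p (pi x.1) (+) eps) && (p (pi x.2) (+) eps)).
pose S C := \big[addb/false]_(x : 'I_n * 'I_n) (C x && G x).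
pose t := tperm i j.
pose lt0 (x : 'I_n * 'I_n) := (x.1 < x.2)%N.
pose lt1 (x : 'I_n * 'I_n) := (t x.1 < t x.2)%N.
pose E (x : 'I_n * 'I_n) := (x == (i, j)) || (x == (j, i)).
have neq_ij : i != j by apply/eqP=> Eij; move: Ej; rewrite Eij; lia.
have signE : koszul_sign eps p pi = S lt0.
  rewrite /S -(pair_bigA _ (fun a b => lt0 (a, b) && G (a, b))) /=.
  apply: eq_bigr => a _; rewrite big_mkcond; apply: eq_bigr => b _.
  by rewrite /lt0 /G /=; case: (a < b)%N => //=; case: (_ < _)%N.
have signtE : koszul_sign eps p (tperm i j * pi)%g = S lt1.
  rewrite /S (reindex_inj (h := fun x => (t x.1, t x.2))) /=; last first.
    by move=> [a b] [a' b'] /= [/perm_inj -> /perm_inj ->].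
  rewrite -(pair_bigA _ (fun a b => lt1 (t a, t b) && G (t a, t b))) /=.
  apply: eq_bigr => a _; rewrite big_mkcond; apply: eq_bigr => b _.
  rewrite /lt1 /G /= !tpermK !permM -/t.
  by case: (a < b)%N => //=; case: (_ < _)%N.
have lt1E x : lt1 x = lt0 x (+) E x.
  case: x => a b; rewrite /lt1 /lt0 /E /t /= !xpair_eqE -!val_eqE /=.
  case: tpermP => [->|->|/eqP + /eqP]; case: tpermP => [->|->|/eqP + /eqP];
    rewrite -?val_eqE /= ?Ej; try lia.
rewrite signE signtE /S; under eq_bigr => x _ do rewrite lt1E andb_addl.
rewrite big_split /=; congr (_ (+) _).
rewrite (bigD1 (i, j)) // (bigD1 (j, i)) /=; last first.
  by rewrite xpair_eqE eq_sym negb_and neq_ij.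
rewrite big1 => [|x /andP[/negbTE x1 /negbTE x2]]; last by rewrite /E x1 x2.
rewrite /E !eqxx orbT /= addbF /G /=.
have : pi i != pi j by rewrite (inj_eq perm_inj).
rewrite [in X in _ (+) (_ && X)]andbC -val_eqE /=.
by case: ltngtP => //=; rewrite ?addbF.
Qed.

Lemma koszul_signP (K : numFieldType) (V : lmodType K) (f : 'S_n -> V) :
  (forall (pi : 'S_n) (i j : 'I_n), j = i.+1 :> nat ->
     f (tperm i j * pi)%g
       = (-1) ^+ ((p (pi i) (+) eps) && (p (pi j) (+) eps)) *: f pi) ->
  forall pi : 'S_n, f pi = (-1) ^+ koszul_sign eps p pi *: f 1%g.
Proof.
move=> fP; pose g (pi : 'S_n) := (-1) ^+ koszul_sign eps p pi *: f pi.
have gS (i j : 'I_n) pi : j = i.+1 :> nat -> g (tperm i j * pi)%g = g pi.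
  move=> Ej; rewrite /g fP // scalerA koszul_sign_exchange // signr_addb.
  by rewrite -mulrA -expr2 sqrr_sign mulr1.
have gT d : forall (i j : 'I_n) pi, (j = i + d.+1 :> nat)%N ->
    g (tperm i j * pi)%g = g pi.
  elim: d => [|d IH] i j pi Ej; first by apply: gS; rewrite Ej addn1.
  have lt_k : (i + d.+1 < n)%N by have := ltn_ord j; lia.
  pose k := Ordinal lt_k.
  have Ekj : j = k.+1 :> nat by rewrite /=; lia.
  have neq_ik : i != k by apply/eqP=> /(congr1 val) /=; lia.
  have neq_ij : i != j by apply/eqP=> Eij; move: Ej; rewrite Eij; lia.
  have -> : tperm i j = (tperm k j * (tperm i k * tperm k j))%g.
    have := tpermJ i k (tperm k j); rewrite tpermL tpermD 1?eq_sym // => <-.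
    by rewrite /conjg tpermV.
  by rewrite -!mulgA gS // IH // gS.
have gE pi : g pi = g 1%g.
  have [ts -> dts] := prod_tpermP pi.
  elim: ts dts => [|[i j] ts IH] /=; first by rewrite big_nil.
  rewrite big_cons /= => /andP[neq_ij /IH <-].
  have [lt_ij|lt_ji|/val_inj eq_ij] := ltngtP i j.
  - by apply: (gT (j - i.+1)%N); rewrite addnS -addSn subnKC.
  - by rewrite tpermC; apply: (gT (i - j.+1)%N); rewrite addnS -addSn subnKC.
  - by rewrite eq_ij eqxx in neq_ij.
move=> pi; have := gE pi; rewrite /g koszul_sign_id expr0 scale1r => <-.
by rewrite scalerA -expr2 sqrr_sign scale1r.
Qed.

End KoszulSign.

(* A family of maps Phi^n, n >= 0: Phi s is Phi^n(a_1, ..., a_n) when         *)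
(* s = [:: a_1; ...; a_n].                                                    *)
Definition bracket (A : Type) := seq A -> A.

Definition permute_word (T : Type) (w : seq T) (pi : 'S_(size w)) : seq T :=
  [seq tnth (in_tuple w) (pi i) | i <- enum 'I_(size w)].

(* A word [:: (p_1, a_1); ...; (p_n, a_n)] lists homogeneous arguments a_i    *)
(* with their parities p_i.                                                   *)
Definition word_sign (eps : bool) (A : Type) (w : seq (bool * A))
    (pi : 'S_(size w)) : bool :=
  koszul_sign eps (fun i => (tnth (in_tuple w) i).1) pi.

(* Formulas with parity-dependent signs make sense on homogeneous arguments;  *)
(* this is their multilinear extension to arbitrary arguments.                *)
Definition multilinear_ext (K : numFieldType) (A : gradedSpace K)
    (F : seq (bool * A) -> A) : bracket A :=
  fun s => \sum_(p : (size s).-tuple bool)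
    F [seq (x.1, gpart x.1 x.2) | x <- zip p s].

(* u_1 . ... . u_i . D(v_1 . ... . v_j . e) . w_1 . ... . w_k                 *)
Definition sandwich (K : numFieldType) (eps : bool) (A : gradedAlgebra K eps)
    (e : A) (D : A -> A) (u v w : seq A) : A :=
  foldl (@gmul K eps A)
    (foldr (@gmul K eps A) (D (foldr (@gmul K eps A) e v)) u) w.

Definition koszul_bracket_hom (K : numFieldType) (eps : bool)
    (A : gradedAlgebra K eps) (e : A) (D : A -> A) (w : seq (bool * A)) : A :=
  let n := size w in
  \sum_(i < n.+1) \sum_(j < n.+1) \sum_(k < n.+1 | (i + j + k)%N == n)
    (koszulB K i k / (i`! * j`! * k`!)%:R) *:
    \sum_(pi : 'S_n)
      (let v := permute_word pi in
       (-1) ^+ (word_sign eps pi + \sum_(x <- take i v) x.1 + i * eps)%N *: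
         sandwich e D [seq x.2 | x <- take i v]
                      [seq x.2 | x <- take j (drop i v)]
                      [seq x.2 | x <- drop (i + j)%N v]).

Definition koszul_bracket (K : numFieldType) (eps : bool)
    (A : gradedAlgebra K eps) (e : A) (D : A -> A) : bracket A :=
  multilinear_ext (koszul_bracket_hom e D).

Definition bracket_product (K : numFieldType) (c : nat -> nat -> K)
    (eps : bool) (A : gradedAlgebra K eps) (Phi Phi' : bracket A) : bracket A :=
  multilinear_ext (fun w : seq (bool * A) =>
    let n := size w in
    \sum_(k < n.+1) (c n k / (k`! * (n - k)`!)%:R) *:
      \sum_(pi : 'S_n)
        (let v := [seq x.2 | x <- permute_word pi] in
         (-1) ^+ word_sign eps pi *: Phi (Phi' (take k v) :: drop k v))).

(* Main.v *)
From HB Require Import structures.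
Require Import Defs.
From mathcomp Require Import all_boot all_order all_fingroup all_algebra.
From mathcomp Require Import boolp zify ring.
From mathcomp Require Import reals complex.

Set Implicit Arguments.
Unset Strict Implicit.
Unset Printing Implicit Defensive.

Import Order.TTheory GRing.Theory Num.Theory.
Local Open Scope ring_scope.

(* Without its sum over permutations, the Koszul bracket of Delta is a family of
   maps E^n on ordered words, E(v) being the sum over v = u m w of
   B_{|u|,|w|} / (|u|! |m|! |w|!) (+/-) u Delta(m e) w. In a bracket product the
   inner and outer symmetrizations collapse into a single one, so that
   Phi o Phi is the signed symmetrization of the sum over v = z y z' of
   c^n_{|y|} (+/-) E(z E(y) z'). For constant coefficients this sum already
   vanishes on ordered words, i.e. E is an A_infinity structure: E is determined
   by dexp_x(E(x)) = Delta(e^x e), the flow e^x |-> Delta(e^x e) squares to zero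
   by nilpotency, and dexp_x is invertible.
   Conversely, take K[a, theta] with a even, theta odd, e = 1, and let Delta map
   a^i to theta and a theta to a^(i+1), killing all other monomials. On n > i
   arguments equal to a, Phi o Phi is a nonzero multiple of
   (c^n_i - c^n_{i+1}) a^n. *)

(** * Sums over the splittings of a word *)

Lemma sum_triangle (V : nmodType) (n : nat) (F : nat -> nat -> V) :
  \sum_(i < n.+1) \sum_(j < (n - i).+1) F i j
    = \sum_(i < n.+1) \sum_(j < n.+1 | (i + j <= n)%N) F i j.
Proof.
apply: eq_bigr => i _.
rewrite (big_ord_widen n.+1 (F i)); last by lia.
by apply: eq_bigl => j /=; have := ltn_ord i; lia.
Qed.

Lemma sum_triangle_exchange (V : nmodType) (n : nat) (F : nat -> nat -> V) :
  \sum_(i < n.+1) \sum_(j < (n - i).+1) F i j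
    = \sum_(j < n.+1) \sum_(i < (n - j).+1) F i j.
Proof.
rewrite sum_triangle (exchange_big_dep predT) //=.
rewrite (sum_triangle n (fun j i => F i j)).
by apply: eq_bigr => j _; apply: eq_bigl => i; rewrite addnC.
Qed.

Section Cut.
Variable T : Type.
Implicit Types (v a b : seq T).

(** Deconcatenation of words, empty pieces allowed. With all sums phrased through [cut] and [cut3],
    reindexing becomes coassociativity. *)
Definition cut (V : nmodType) (f : seq T -> seq T -> V) v : V :=
  \sum_(i < (size v).+1) f (take i v) (drop i v).

Definition cut3 (V : nmodType) (f : seq T -> seq T -> seq T -> V) v : V :=
  cut (fun a t => cut (f a) t) v.

Lemma eq_cut (V : nmodType) (f g : seq T -> seq T -> V) v :
  (forall a b, v = a ++ b -> f a b = g a b) -> cut f v = cut g v.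
Proof. by move=> fg; apply: eq_bigr => i _; apply: fg; rewrite cat_take_drop. Qed.

Lemma eq_cut3 (V : nmodType) (f g : seq T -> seq T -> seq T -> V) v :
  (forall a b c, v = a ++ b ++ c -> f a b c = g a b c) ->
  cut3 f v = cut3 g v.
Proof.
move=> fg; apply: eq_cut => a t def_v; apply: eq_cut => b c def_t.
by apply: fg; rewrite def_v def_t.
Qed.

Lemma cut_nil (V : nmodType) (f : seq T -> seq T -> V) : cut f [::] = f [::] [::].
Proof. by rewrite /cut big_ord_recl big_ord0 addr0. Qed.

Lemma cut_cons (V : nmodType) (f : seq T -> seq T -> V) x v :
  cut f (x :: v) = f [::] (x :: v) + cut (fun a => f (x :: a)) v.
Proof. by rewrite /cut big_ord_recl. Qed.

Lemma cutD (V : nmodType) (f g : seq T -> seq T -> V) v :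
  cut (fun a b => f a b + g a b) v = cut f v + cut g v.
Proof. exact: big_split. Qed.

Lemma cut3_eq0 (V : nmodType) (f : seq T -> seq T -> seq T -> V) v :
  (forall a b c, v = a ++ b ++ c -> f a b c = 0) -> cut3 f v = 0.
Proof.
move=> f0; rewrite (@eq_cut3 _ f (fun _ _ _ => 0)) //.
by rewrite /cut3 /cut big1 // => i _; apply: big1_eq.
Qed.

Lemma cut3D (V : nmodType) (f g : seq T -> seq T -> seq T -> V) v :
  cut3 (fun a b c => f a b c + g a b c) v = cut3 f v + cut3 g v.
Proof. by rewrite -cutD; apply: eq_cut => a b _; rewrite cutD. Qed.

Lemma raddf_cut (V W : nmodType) (h : {additive V -> W})
    (f : seq T -> seq T -> V) v :
  h (cut f v) = cut (fun a b => h (f a b)) v.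
Proof. exact: raddf_sum. Qed.

Lemma raddf_cut3 (V W : nmodType) (h : {additive V -> W})
    (f : seq T -> seq T -> seq T -> V) v :
  h (cut3 f v) = cut3 (fun a b c => h (f a b c)) v.
Proof. by rewrite raddf_cut; apply: eq_cut => a b _; rewrite raddf_cut. Qed.

Lemma cut_cat_cons (V : nmodType) (f : seq T -> seq T -> V) a x b :
  cut f (a ++ x :: b) = cut (fun a1 a2 => f a1 (a2 ++ x :: b)) a
                      + cut (fun b1 b2 => f (a ++ x :: b1) b2) b.
Proof.
elim: a f => [|y a IH] f /=; first by rewrite cut_cons cut_nil.
by rewrite !cut_cons IH addrA.
Qed.

(** Coassociativity of deconcatenation: both sides run over all splittings into three pieces. *)
Lemma cutA (V : nmodType) (f : seq T -> seq T -> seq T -> V) v :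
  cut (fun x c => cut (fun a b => f a b c) x) v = cut3 f v.
Proof.
elim: v f => [|x v IH] f; first by rewrite /cut3 !cut_nil.
rewrite /cut3 !cut_cons cut_nil -addrA; congr (_ + _).
under eq_cut => a b _ do rewrite cut_cons.
by rewrite cutD (IH (fun a => f (x :: a))).
Qed.

(** The three terms correspond to the piece holding the marked letter [x]: last, middle, first. This
    trichotomy locates an inserted bracket value. *)
Lemma cut3_cat_cons (V : nmodType) (f : seq T -> seq T -> seq T -> V) a x b :
  cut3 f (a ++ x :: b)
  = cut3 (fun p q r => f p q (r ++ x :: b)) a
  + cut (fun p q1 => cut (fun q2 r => f p (q1 ++ x :: q2) r) b) a
  + cut3 (fun p q r => f (a ++ x :: p) q r) b.
Proof.
rewrite /cut3 cut_cat_cons; congr (_ + _).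
by under eq_cut => a1 a2 _ do rewrite cut_cat_cons; rewrite cutD.
Qed.

Lemma cut_cut3 (V : nmodType) (f : seq T -> seq T -> seq T -> seq T -> V) v :
  cut (fun x d => cut3 (fun a b c => f a b c d) x) v
  = cut3 (fun a b x => cut (f a b) x) v.
Proof.
rewrite /cut3 (cutA (fun a x d => cut (fun b c => f a b c d) x)).
by apply: eq_cut => a x _; rewrite cutA.
Qed.

Lemma exchange_cut (V : nmodType)
    (f : seq T -> seq T -> seq T -> seq T -> V) v w :
  cut (fun a b => cut (fun c d => f a b c d) w) v
  = cut (fun c d => cut (fun a b => f a b c d) v) w.
Proof. exact: exchange_big. Qed.

Lemma cut3_cutl (V : nmodType)
    (f : seq T -> seq T -> seq T -> seq T -> seq T -> V) v :
  cut3 (fun x d e => cut3 (fun a b c => f a b c d e) x) v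
  = cut3 (fun a b x => cut3 (fun c d e => f a b c d e) x) v.
Proof.
rewrite -(cut_cut3 (fun a b c t => cut (fun d e => f a b c d e) t)).
apply: eq_cut => x t _; rewrite /cut3 exchange_cut.
by apply: eq_cut => a b _; rewrite exchange_cut.
Qed.

(** Both sides run over all splittings into five pieces, first nested as a (b c d) e, then grouped
    around the middle piece as (a b) c (d e). *)
Lemma cut3_cut3 (V : nmodType)
    (f : seq T -> seq T -> seq T -> seq T -> seq T -> V) v :
  cut3 (fun a x e => cut3 (fun b c d => f a b c d e) x) v
  = cut3 (fun x c y => cut (fun a b => cut (fun d e => f a b c d e) y) x) v.
Proof.
rewrite /cut3.
under [RHS]eq_cut => x t _ do
  (rewrite (exchange_cut (fun c y a b => cut (fun d e => f a b c d e) y))).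
rewrite (cutA (fun a b t => cut (fun c y => cut (fun d e => f a b c d e) y) t)).
by apply: eq_cut => a s _; rewrite (cut_cut3 (fun b c d e => f a b c d e)).
Qed.

End Cut.

Lemma cut_scalel (T : Type) (K : pzRingType) (A : lmodType K)
    (f : seq T -> seq T -> K) (v : seq T) (X : A) :
  cut (fun a b => f a b *: X) v = cut f v *: X.
Proof. by rewrite /cut scaler_suml. Qed.

Lemma cut3_scalel (T : Type) (K : pzRingType) (A : lmodType K)
    (f : seq T -> seq T -> seq T -> K) (v : seq T) (X : A) :
  cut3 (fun a b c => f a b c *: X) v = cut3 f v *: X.
Proof. by rewrite /cut3 -cut_scalel; apply: eq_cut => a b _; rewrite cut_scalel. Qed.

Lemma mul_cut3 (T : Type) (K : pzRingType) (k : K)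
    (f : seq T -> seq T -> seq T -> K) (v : seq T) :
  k * cut3 f v = cut3 (fun a b c => k * f a b c) v.
Proof. by rewrite /cut3 /cut mulr_sumr; apply: eq_bigr => i _; rewrite mulr_sumr. Qed.

Lemma cut3_id (T : Type) (V : nmodType) (f : seq T -> seq T -> seq T -> V) (v : seq T) :
  (forall a b c, v = a ++ b ++ c -> (0 < size a + size c)%N -> f a b c = 0) ->
  cut3 f v = f [::] v [::].
Proof.
move=> f0; rewrite /cut3 {1}/cut big_ord_recl take0 drop0 /=.
rewrite [X in _ + X]big1 ?addr0 => [|i _]; last first.
  rewrite -[RHS](_ : cut (fun _ _ => 0) (drop i.+1 v) = 0); last exact: big1_eq.
  apply: eq_cut => b c def_d; apply: f0; rewrite -?def_d ?cat_take_drop //.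
  by rewrite size_takel // addSn.
rewrite /cut big_ord_recr /= take_size drop_size big1 ?add0r // => i _.
by apply: f0; rewrite /= ?cat_take_drop // size_drop subn_gt0.
Qed.

Lemma cut_size (T : Type) (V : nmodType) (f : nat -> nat -> V) (v : seq T) :
  cut (fun a b => f (size a) (size b)) v
  = \sum_(i < (size v).+1) f i (size v - i)%N.
Proof.
apply: eq_bigr => i _; rewrite size_drop size_takel //.
by rewrite -ltnS.
Qed.

Lemma cut_sizeC (T : Type) (V : nmodType) (f : nat -> nat -> V) (v : seq T) :
  cut (fun a b => f (size a) (size b)) v
  = cut (fun a b => f (size b) (size a)) v.
Proof.
rewrite !cut_size (reindex_inj rev_ord_inj) /=.
rewrite (cut_size (fun i j => f j i)).
by apply: eq_bigr => i _; rewrite subSS subKn // -ltnS.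
Qed.

(** * The numbers B *)

Section KoszulNumbers.
Variable K : numFieldType.

Definition egfB (k l : nat) : K := egf2 (koszulB K) k l.

(* The coefficients of (e^x - e^y) / (x - y). *)
Definition exp_ddiff (k l : nat) : K := ((k + l).+1)`!%:R^-1.

(** The defining relation of B is this one multiplied by x - y. Cancelling that factor amounts to
    propagating coefficients along antidiagonals, starting from m = 0. *)
Lemma egfB_exp_ddiff m n :
  psmul2 egfB exp_ddiff m n = ((m == 0) && (n == 0))%:R.
Proof.
have eqB k l := etrans (esym (psmul2_exp_diff egfB k l)) (koszulBP K k l).
elim: m n => [|m IH] n.
  by have := eqB 0 n.+1; rewrite /x_minus_y /= !sub0r => /oppr_inj ->.
have := eqB m.+1 n.+1; rewrite /x_minus_y /= !andbF subr0.
move/eqP; rewrite subr_eq0 => /eqP <-.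
by rewrite IH andbF.
Qed.

(** The same inversion of series, with [v] to the left and [w] to the right of Delta: B weighs the
    inner pieces [u] and [x], the divided difference the outer ones. *)
Lemma cut_egfB_exp_ddiff (T : Type) (v w : seq T) :
  cut (fun a u => cut (fun x b => egfB (size u) (size x) *
                                   exp_ddiff (size a) (size b)) w) v
  = ((size v == 0) && (size w == 0))%:R.
Proof.
rewrite -egfB_exp_ddiff /psmul2.
pose F i j := \sum_(l < (size w).+1) egfB i l * exp_ddiff j (size w - l).
rewrite -(cut_size F v) (cut_sizeC F v); apply: eq_cut => a u _.
exact: (cut_size (fun i j => egfB (size u) i * exp_ddiff (size a) j)).
Qed.

(** The coefficient of x^n in B(x, x), where B(x, y) is the generating series. *)
Definition egfB_diag (n : nat) : K := \sum_(i < n.+1) egfB i (n - i).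

Lemma cut_egfB (T : Type) (v : seq T) :
  cut (fun a b => egfB (size a) (size b)) v = egfB_diag (size v).
Proof. exact: cut_size. Qed.

(* On the diagonal x = y, the defining relation of B reads B(x, x) e^x = 1. *)
Lemma egfB_diag_exp n :
  \sum_(i < n.+1) egfB_diag i / (n - i)`!%:R = (n == 0)%:R.
Proof.
pose v := nseq n tt; have sv : size v = n by rewrite size_nseq.
(* Both sides are compared with the coefficient of x^n in the product of the two series at y = x, a
   sum over splittings into four pieces. *)
transitivity (cut (fun a b =>
    cut (fun a1 a2 => cut (fun b1 b2 =>
      egfB (size a1) (size b1) * exp_ddiff (size a2) (size b2)) b) a) v).
- pose g (a1 a2 b1 b2 : seq unit) : K :=
    egfB (size a1) (size b1) * exp_ddiff (size a2) (size b2).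
  have -> : cut (fun a b => cut (fun a1 a2 => cut (g a1 a2) b) a) v
    = cut3 (fun a1 b1 t => cut (fun a2 b2 => g a1 a2 b1 b2) t) v.
    rewrite (cutA (fun a1 a2 b => cut (g a1 a2) b)); apply: eq_cut => a1 t _.
    rewrite -[LHS]/(cut3 (fun a2 b1 b2 => g a1 a2 b1 b2) t).
    rewrite -[RHS]/(cut3 (fun b1 a2 b2 => g a1 a2 b1 b2) t) -!cutA.
    apply: eq_cut => x b2 _; rewrite /g.
    exact: (cut_sizeC (fun i j => egfB (size a1) j * exp_ddiff i (size b2))).
  rewrite -(cutA (fun a1 b1 t => cut (fun a2 b2 => g a1 a2 b1 b2) t)).
  have -> : cut (fun x t => cut (fun a1 b1 => cut (fun a2 b2 => g a1 a2 b1 b2) t) x) v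
    = cut (fun x t => egfB_diag (size x) / (size t)`!%:R) v.
    apply: eq_cut => x t _; rewrite -cut_egfB /cut mulr_suml.
    apply: eq_bigr => i _; rewrite /g -mulr_sumr; congr (_ * _).
    rewrite -/(cut (fun a b => exp_ddiff (size a) (size b)) t) cut_size.
    (* The |t| + 1 cuts of [t] all have weight 1/(|t| + 1)!, so they add up to 1/|t|!: the divided
       difference restricts to e^x on the diagonal. *)
    rewrite (eq_bigr (fun=> (size t).+1`!%:R^-1)) => [|j _]; last first.
      by rewrite /exp_ddiff subnKC // -ltnS.
    rewrite sumr_const card_ord -[LHS]mulr_natr factS natrM.
    by rewrite [(_ * _)^-1]invfM mulrAC mulVf ?mul1r // pnatr_eq0.
  by rewrite (cut_size (fun i j => egfB_diag i / j`!%:R)) sv.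
have E (a b : seq unit) : cut (fun a1 a2 => cut (fun b1 b2 =>
      egfB (size a1) (size b1) * exp_ddiff (size a2) (size b2)) b) a
      = ((size a == 0) && (size b == 0))%:R.
  rewrite -egfB_exp_ddiff /psmul2.
  rewrite -(cut_size (fun i j =>
    \sum_(l < (size b).+1) egfB i l * exp_ddiff j (size b - l))).
  by apply: eq_cut => a1 a2 _;
    rewrite (cut_size (fun i j => egfB (size a1) i * exp_ddiff (size a2) j)).
rewrite (eq_cut (g := fun a b => ((size a == 0) && (size b == 0))%:R)) //.
rewrite (cut_size (fun i j => ((i == 0) && (j == 0))%:R)) sv.
rewrite big_ord_recl subn0 big1 /= ?addr0 //.
Qed.

(** B(x, x) = e^(-x): both coefficient sequences solve the same triangular recursion, for e^(-x) by
    expanding (1 - 1)^n. *)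
Lemma egfB_diagE n : egfB_diag n = (-1) ^+ n / n`!%:R.
Proof.
elim/ltn_ind: n => n IH.
have fact_neq0 m : m`!%:R != 0 :> K by rewrite pnatr_eq0 -lt0n fact_gt0.
have := egfB_diag_exp n; rewrite big_ord_recr /= subnn divr1.
have <- : \sum_(i < n.+1) (-1) ^+ i / i`!%:R / (n - i)`!%:R = (n == 0)%:R :> K.
  have -> : (n == 0)%:R = n`!%:R^-1 * (1 - 1) ^+ n :> K.
    by rewrite subrr expr0n; case: n {IH} => [|n]; rewrite ?invr1 ?mulr1 ?mulr0.
  rewrite exprBn mulr_sumr; apply: eq_bigr => i _.
  rewrite !expr1n !mulr1 -mulr_natr -(bin_fact (ltn_ord i : (i <= n)%N)).
  rewrite !natrM !invfM; field.
  by rewrite !fact_neq0 pnatr_eq0 -lt0n bin_gt0 -ltnS ltn_ord.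
rewrite big_ord_recr /= subnn divr1 (eq_bigr (fun i : 'I_n =>
  (-1) ^+ i / i`!%:R / (n - i)`!%:R)) => [/addrI // | i _].
by rewrite IH.
Qed.

End KoszulNumbers.

(** * Signed symmetrization *)

Section SignedSum.
Variables (K : numFieldType) (eps : bool) (A : lmodType K).
Implicit Types (w v y z : seq (bool * A)) (V : lmodType K).

Let x0 : bool * A := (false, 0).

(** The suspended parity of a word, each letter being shifted by [eps]; exchanging two adjacent
    words costs the product of these parities. *)
Definition wpar w : bool := \big[addb/false]_(x <- w) (x.1 (+) eps).

Lemma wpar_nil : wpar [::] = false. Proof. exact: big_nil. Qed.

Lemma wpar_cons x w : wpar (x :: w) = (x.1 (+) eps) (+) wpar w.
Proof. exact: big_cons. Qed.

Lemma wpar_cat w v : wpar (w ++ v) = wpar w (+) wpar v.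
Proof. exact: big_cat. Qed.

Lemma wpar_take r w : (r <= size w)%N ->
  wpar (take r w) = \big[addb/false]_(i < r) ((nth x0 w i).1 (+) eps).
Proof.
move=> le_r; rewrite /wpar (big_nth x0) size_takel // big_mkord.
by apply: eq_bigr => i _; rewrite nth_take.
Qed.

Definition symm V (F : seq (bool * A) -> V) w : V :=
  \sum_(pi : 'S_(size w)) (-1) ^+ word_sign eps pi *: F (permute_word pi).

(** Unlike in [permute_word], the degree [n] is independent of the word, so one group ['S_n] acts on
    all rearrangements of a word. *)
Definition rearr n (pi : 'S_n) w : seq (bool * A) :=
  [seq nth x0 w (pi i) | i <- enum 'I_n].

Definition rsign n (pi : 'S_n) w : bool :=
  koszul_sign eps (fun i => (nth x0 w i).1) pi.

Lemma size_rearr n (pi : 'S_n) w : size (rearr pi w) = n.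
Proof. by rewrite size_map size_enum_ord. Qed.

Lemma nth_rearr n (pi : 'S_n) w (i : 'I_n) :
  nth x0 (rearr pi w) i = nth x0 w (pi i).
Proof. by rewrite (nth_map i) ?size_enum_ord // nth_ord_enum. Qed.

Lemma rearrP n (pi : 'S_n) w v : size v = n ->
  (forall i : 'I_n, nth x0 v i = nth x0 w (pi i)) -> rearr pi w = v.
Proof.
move=> sv nth_v; apply: (@eq_from_nth _ x0); rewrite size_rearr //.
by move=> j lt_j; rewrite (nth_rearr pi w (Ordinal lt_j)) -nth_v.
Qed.

Lemma symmE V (F : seq (bool * A) -> V) n w : size w = n ->
  symm F w = \sum_(pi : 'S_n) (-1) ^+ rsign pi w *: F (rearr pi w).
Proof.
move<-; apply: eq_bigr => pi _; congr (_ ^+ _ *: F _).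
  rewrite /word_sign /rsign; congr (nat_of_bool (koszul_sign _ _ _)).
  by apply/funext => i; rewrite (tnth_nth x0).
apply/esym; apply: rearrP; first by rewrite size_map size_enum_ord.
by move=> i; rewrite (nth_map i) ?size_enum_ord // nth_ord_enum (tnth_nth x0).
Qed.

Lemma eq_symm V (F G : seq (bool * A) -> V) w :
  (forall v, perm_eq v w -> F v = G v) -> symm F w = symm G w.
Proof.
move=> eqFG; rewrite !(symmE _ (erefl (size w))); apply: eq_bigr => pi _.
congr (_ *: _); apply: eqFG; apply/(perm_iotaP x0).
exists [seq val (pi i) | i <- enum 'I_(size w)]; last by rewrite -map_comp.
rewrite -val_enum_ord (map_comp val pi); apply: perm_map.
apply: uniq_perm; first by rewrite map_inj_uniq ?enum_uniq //; apply: perm_inj.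
  exact: enum_uniq.
move=> i; rewrite mem_enum; apply/mapP; exists (pi^-1 i)%g; rewrite ?mem_enum //.
by rewrite permKV.
Qed.

(** Cocycle rule: as a function of [s], the sign of [s * t] obeys the neighbour exchange rule for
    the parities [p \o t], and [koszul_signP] determines such a function from its value at the
    identity. *)
Lemma koszul_signM n (p : 'I_n -> bool) (s t : 'S_n) :
  koszul_sign eps p (s * t)%g
  = koszul_sign eps p t (+) koszul_sign eps (p \o t) s.
Proof.
pose f (u : 'S_n) : K^o := (-1) ^+ koszul_sign eps p (u * t)%g.
have /(_ _ s) := @koszul_signP eps n (p \o t) K K^o f.
rewrite /f mul1g => fP; apply: (@signr_inj K).
rewrite signr_addb mulrC; apply: fP => pi i j Eij.
by rewrite -mulgA koszul_sign_exchange // signr_addb mulrC !permM.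
Qed.

Lemma rearrM n (s t : 'S_n) w : rearr (s * t)%g w = rearr s (rearr t w).
Proof.
by apply: rearrP => [|i]; rewrite ?size_rearr // !nth_rearr permM.
Qed.

Lemma rsignM n (s t : 'S_n) w :
  rsign (s * t)%g w = rsign t w (+) rsign s (rearr t w).
Proof.
rewrite /rsign koszul_signM; congr (_ (+) koszul_sign _ _ _).
by apply/funext => i /=; rewrite nth_rearr.
Qed.

(** Reindexing the group by multiplication with [s] absorbs a fixed signed rearrangement. *)
Lemma symm_rearr V (F : seq (bool * A) -> V) n (s : 'S_n) w : size w = n ->
  symm (fun v => (-1) ^+ rsign s v *: F (rearr s v)) w = symm F w.
Proof.
move=> sw; rewrite !(symmE _ sw) [RHS](reindex_inj (mulgI s)).
by apply: eq_bigr => t _; rewrite rearrM rsignM signr_addb -scalerA.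
Qed.

Lemma symm_sum V I (r : seq I) (P : pred I) (F : I -> seq (bool * A) -> V) w :
  symm (fun v => \sum_(i <- r | P i) F i v) w = \sum_(i <- r | P i) symm (F i) w.
Proof. by rewrite exchange_big; apply: eq_bigr => pi _; rewrite scaler_sumr. Qed.

Lemma symmZ V k (F : seq (bool * A) -> V) w :
  symm (fun v => k *: F v) w = k *: symm F w.
Proof.
rewrite scaler_sumr; apply: eq_bigr => pi _.
by rewrite !scalerA mulrC.
Qed.

(** * Permutations preserving an initial block and its complement *)

Section Block.
Variables (k m : nat) (s : 'S_k) (t : 'S_m).

Definition block_fun (i : 'I_(k + m)) : 'I_(k + m) :=
  unsplit (match split i with inl j => inl (s j) | inr j => inr (t j) end).

Lemma block_fun_inj : injective block_fun.
Proof.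
move=> i j /(can_inj unsplitK); rewrite -(splitK i) -(splitK j) !unsplitK.
by case: (split i) (split j) => i1 [] j1 // [/perm_inj ->].
Qed.

Definition block_perm : 'S_(k + m) := perm block_fun_inj.

Lemma block_permL i : block_perm (lshift m i) = lshift m (s i).
Proof. by rewrite permE /block_fun (unsplitK (inl i)). Qed.

Lemma block_permR i : block_perm (rshift k i) = rshift k (t i).
Proof. by rewrite permE /block_fun (unsplitK (inr i)). Qed.

Lemma rearr_block w : size w = (k + m)%N ->
  rearr block_perm w = rearr s (take k w) ++ rearr t (drop k w).
Proof.
move=> sw; apply: rearrP => [|i]; first by rewrite size_cat !size_rearr.
rewrite nth_cat size_rearr; case: (split_ordP i) => j -> /=.
  by rewrite nth_rearr nth_take // block_permL.
by rewrite addKn nth_rearr nth_drop block_permR.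
Qed.

(** No inversion joins the two blocks, so the sum over inversions splits. *)
Lemma rsign_block w : size w = (k + m)%N ->
  rsign block_perm w = rsign s (take k w) (+) rsign t (drop k w).
Proof.
move=> sw; rewrite /rsign /koszul_sign big_split_ord; congr (_ (+) _).
  apply: eq_bigr => i _; rewrite big_mkcond big_split_ord /=.
  rewrite [X in _ (+) X]big1 ?addbF => [|j _].
    rewrite -big_mkcond; apply: eq_big => j; first by rewrite !block_permL.
    by move=> _; rewrite !block_permL /= !nth_take.
  rewrite block_permL block_permR /=.
  by rewrite [(k + t j < s i)%N]ltnNge (leq_trans (ltnW (ltn_ord (s i)))) ?leq_addr
    // andbF.
apply: eq_bigr => i _; rewrite big_mkcond big_split_ord /=.
rewrite [X in X (+) _]big1 ?addFb => [|j _].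
  rewrite -big_mkcond; apply: eq_big => j.
    by rewrite !block_permR /= !ltn_add2l.
  by move=> _; rewrite !block_permR /= !nth_drop.
by rewrite [(k + i < j)%N]ltnNge (leq_trans (ltnW (ltn_ord j))) ?leq_addr.
Qed.

End Block.

(** Each of the k! (n - k)! pairs of inner permutations is a block permutation, which the outer
    symmetrization absorbs. This cancels the factorials of the bracket product. *)
Lemma symm_block V (G : seq (bool * A) -> seq (bool * A) -> V) k w :
  (k <= size w)%N ->
  symm (fun v => symm (fun y => symm (G y) (drop k v)) (take k v)) w
  = (k`! * (size w - k)`!)%:R *: symm (fun v => G (take k v) (drop k v)) w.
Proof.
move=> le_k; pose m := (size w - k)%N; rewrite -/m.
have sw : size w = (k + m)%N by rewrite subnKC.
transitivity (\sum_(s : 'S_k) \sum_(t : 'S_m)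
    symm (fun v => G (take k v) (drop k v)) w); last first.
  by rewrite !sumr_const !card_Sn -mulrnA -scaler_nat mulnC.
rewrite (eq_symm (G := fun v => \sum_(s : 'S_k) \sum_(t : 'S_m)
  (-1) ^+ rsign (block_perm s t) v *:
    (fun v => G (take k v) (drop k v)) (rearr (block_perm s t) v))) => [|v].
  rewrite symm_sum; apply: eq_bigr => s _; rewrite symm_sum.
  apply: eq_bigr => t _.
  exact: (symm_rearr (fun v => G (take k v) (drop k v)) (block_perm s t) sw).
move=> /perm_size; rewrite sw => sv.
rewrite (symmE _ (n := k)) ?size_takel ?sv ?leq_addr //.
apply: eq_bigr => s _; rewrite (symmE _ (n := m)) ?size_drop ?sv ?addKn //.
rewrite scaler_sumr; apply: eq_bigr => t _.
rewrite rsign_block // rearr_block // take_size_cat ?drop_size_cat ?size_rearr //.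
by rewrite signr_addb scalerA.
Qed.

(** * Exchange of two adjacent blocks at the start of a word *)

Section Swap.
Variables (n k r : nat).
Hypothesis le_n : (k + r <= n)%N.

(** The old position read at the new position [i], when the [r] letters that follow the first [k]
    are moved in front of them. *)
Definition swap_nat (i : nat) : nat :=
  if (i < r)%N then (k + i)%N else if (i < r + k)%N then (i - r)%N else i.

Lemma swap_nat_lt (i : 'I_n) : (swap_nat i < n)%N.
Proof.
rewrite /swap_nat; have := ltn_ord i.
by case: (ltnP i r); case: (ltnP i (r + k)); lia.
Qed.

Lemma swap_fun_inj : injective (fun i => Ordinal (swap_nat_lt i)).
Proof.
move=> i j /(congr1 val) /=; rewrite /swap_nat => eq_ij; apply: val_inj => /=.
move: eq_ij; case: (ltnP i r); case: (ltnP i (r + k));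
  by case: (ltnP j r); case: (ltnP j (r + k)); lia.
Qed.

Definition swap_perm : 'S_n := perm swap_fun_inj.

Lemma swap_permE i : swap_perm i = swap_nat i :> nat.
Proof. by rewrite permE. Qed.

Lemma rearr_swap w : size w = n ->
  rearr swap_perm w = take r (drop k w) ++ take k w ++ drop r (drop k w).
Proof.
move=> sw; have sd : size (drop k w) = (n - k)%N by rewrite size_drop sw.
apply: rearrP => [|i].
  rewrite !size_cat size_drop !size_takel ?sw ?sd; lia.
rewrite swap_permE /swap_nat !nth_cat !size_takel ?sw ?sd; try lia.
case: ltnP => [lt_ir|le_ri]; first by rewrite nth_take // nth_drop.
have -> : (i < r + k)%N = (i - r < k)%N by lia.
case: ltnP => [lt_ik|le_ki]; first by rewrite nth_take.
by rewrite !nth_drop; congr (nth _ _ _); lia.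
Qed.

(** The inversions are exactly the pairs with one letter in each block, so their sum factors into a
    product of two parities. *)
Lemma rsign_swap w : size w = n ->
  rsign swap_perm w = wpar (take k w) && wpar (take r (drop k w)).
Proof.
move=> sw; pose P i := (nth x0 w i).1 (+) eps.
rewrite andbC !wpar_take ?size_drop ?sw; try lia.
transitivity ((\big[addb/false]_(i < n | (i < r)%N) P (swap_nat i)) &&
              (\big[addb/false]_(j < n | (r <= j < r + k)%N) P (swap_nat j))).
  rewrite big_distrlr [RHS]big_mkcond /=; apply: eq_bigr => i _.
  transitivity (\big[addb/false]_(j < n | ((i < r) && (r <= j < r + k))%N)
     (P (swap_nat i) && P (swap_nat j))).
    apply: eq_big => j; rewrite !swap_permE // /swap_nat.
    by case: (ltnP i r); case: (ltnP i (r + k)); case: (ltnP j r);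
      case: (ltnP j (r + k)); lia.
  by case: ltnP => //= _; rewrite big_pred0.
congr (_ && _).
  rewrite (big_ord_widen n (fun i => (nth x0 (drop k w) i).1 (+) eps)); last lia.
  by apply: eq_bigr => i lt_i; rewrite /swap_nat lt_i nth_drop.
rewrite -(big_mkord (fun j => (r <= j < r + k)%N) (fun j => P (swap_nat j))).
rewrite -(big_mkord predT P).
transitivity (\big[addb/false]_(0 + r <= j < r + k) P (swap_nat j)).
  rewrite [RHS](big_nat_widen _ _ n); last lia.
  rewrite [RHS](big_nat_widenl _ 0) //.
  by apply: eq_bigl => j; rewrite add0n andbC.
rewrite big_addn addKn; apply: eq_big_nat => j /andP[_ lt_j].
by congr (P _); rewrite /swap_nat; case: ltnP; [lia | case: ltnP; lia].
Qed.

End Swap.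

Lemma symm_swap V (F : seq (bool * A) -> V) k r w : (k + r <= size w)%N ->
  symm (fun v => (-1) ^+ (wpar (take k v) && wpar (take r (drop k v))) *:
          F (take r (drop k v) ++ take k v ++ drop r (drop k v))) w
  = symm F w.
Proof.
move=> le_w; rewrite -(symm_rearr F (swap_perm le_w) (erefl _)).
apply: eq_symm => v /perm_size sv.
by rewrite rsign_swap // rearr_swap.
Qed.

(** * Insertion of a letter at each position of a permuted word *)

Lemma rearr_lift n (r : 'I_n.+1) (pi : 'S_n) x z : size z = n ->
  rearr (lift_perm r ord0 pi) (x :: z)
  = take r (rearr pi z) ++ x :: drop r (rearr pi z).
Proof.
move=> sz; have le_r : (r <= size (rearr pi z))%N by rewrite size_rearr -ltnS.
apply: rearrP => [|i].
  by rewrite size_cat /= addnS -size_cat cat_take_drop size_rearr.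
rewrite nth_cat size_takel //; case: (unliftP r i) => [j|] -> /=; last first.
  by rewrite lift_perm_id ltnn subnn.
rewrite lift_perm_lift lift0 /= -nth_rearr /bump.
case: (leqP r j) => [le_rj|lt_jr]; last by rewrite add0n lt_jr nth_take.
by rewrite add1n ltnNge ltnW // subSn //= nth_drop subnKC.
Qed.

(** The inversions involving [x] are those with the [r] letters now standing before it. *)
Lemma rsign_lift n (r : 'I_n.+1) (pi : 'S_n) x z : size z = n ->
  rsign (lift_perm r ord0 pi) (x :: z)
  = ((x.1 (+) eps) && wpar (take r (rearr pi z))) (+) rsign pi z.
Proof.
move=> sz; have le_r : (r <= size (rearr pi z))%N by rewrite size_rearr -ltnS.
rewrite /rsign /koszul_sign (bigD1_ord r) //=.
rewrite [X in X (+) _]big_pred0 => [|j]; last first.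
  by rewrite lift_perm_id ltn0 andbF.
rewrite addFb wpar_take //.
have -> : (x.1 (+) eps) && \big[addb/false]_(i < r) ((nth x0 (rearr pi z) i).1 (+) eps)
   = \big[addb/false]_(i < n | (i < r)%N)
       (((nth x0 z (pi i)).1 (+) eps) && (x.1 (+) eps)).
  rewrite andbC (big_ord_widen n
    (fun i => (nth x0 (rearr pi z) i).1 (+) eps)) //; last first.
    by rewrite -ltnS.
  by rewrite big_distrl /=; apply: eq_bigr => i _; rewrite nth_rearr.
rewrite [X in _ = X (+) _]big_mkcond -big_split; apply: eq_bigr => i _ /=.
rewrite big_mkcond (bigD1_ord r) //=; congr (_ (+) _).
  rewrite lift_perm_lift lift_perm_id /= /bump andbT.
  by case: (leqP r i) => [le_ri|lt_ir];
    rewrite ?add1n ?add0n ?lt_ir // ltnNge leqW.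
rewrite -big_mkcond; apply: eq_big => j; rewrite !lift_perm_lift //=.
by rewrite /bump; lia.
Qed.

(** A permutation of [x :: z] amounts to the final position [r] of [x] and a permutation of [z], via
    [lift_perm]. *)
Lemma symm_cons V (F : seq (bool * A) -> V) x z :
  symm F (x :: z) = \sum_(r < (size z).+1)
    symm (fun y => (-1) ^+ ((x.1 (+) eps) && wpar (take r y)) *:
            F (take r y ++ x :: drop r y)) z.
Proof.
set n := size z; pose h (u : 'I_n.+1 * 'S_n) := lift_perm u.1 ord0 u.2.
have h_bij : bijective h.
  apply: inj_card_bij => [[r s] [r' s'] eq_h|]; last first.
    by rewrite card_prod !card_Sn card_ord factS.
  have eq_r : r = r'.
    apply: (@perm_inj _ (h (r, s))); rewrite {2}eq_h.
    by rewrite /h !lift_perm_id.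
  rewrite -{}eq_r in eq_h *; congr (_, _); apply/permP => i.
  have := congr1 (fun u : 'S_n.+1 => u (lift r i)) eq_h.
  by rewrite /h !lift_perm_lift => /lift_inj.
rewrite (symmE _ (n := n.+1)) // (reindex h); last exact: onW_bij.
rewrite -(pair_bigA _ (fun r s => (-1) ^+ rsign (h (r, s)) (x :: z) *:
                                   F (rearr (h (r, s)) (x :: z)))) /=.
apply: eq_bigr => r _; rewrite (symmE _ (n := n)) //; apply: eq_bigr => s _.
by rewrite rsign_lift // rearr_lift // signr_addb mulrC scalerA.
Qed.

End SignedSum.

(** * Products of words *)

Section Products.
Variables (K : numFieldType) (eps : bool) (A : gradedAlgebra K eps).
Implicit Types (u v w : seq (bool * A)) (X Y : A).

Definition rmul (b : A) : A -> A := (@gmul K eps A)^~ b.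

HB.instance Definition _ (a : A) :=
  GRing.isLinear.Build K A A *:%R (gmul a) (gmul_linearr a).
HB.instance Definition _ (b : A) :=
  GRing.isLinear.Build K A A *:%R (rmul b) (gmul_linearl b).

(** The algebra may have no unit, so words act on an element by successive multiplications, and the
    empty word acts as the identity. *)
Definition lprod u X : A := foldr (@gmul K eps A) X [seq x.2 | x <- u].
Definition rprod w X : A := foldl (@gmul K eps A) X [seq x.2 | x <- w].

Lemma lprod_cons x u X : lprod (x :: u) X = gmul x.2 (lprod u X).
Proof. by []. Qed.

Lemma rprod_cons x w X : rprod (x :: w) X = rprod w (gmul X x.2).
Proof. by []. Qed.

Lemma lprod_cat u v X : lprod (u ++ v) X = lprod u (lprod v X).
Proof. by rewrite /lprod map_cat foldr_cat. Qed.

Lemma rprod_cat u v X : rprod (u ++ v) X = rprod v (rprod u X).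
Proof. by rewrite /rprod map_cat foldl_cat. Qed.

Lemma lprod_is_linear u : linear (lprod u).
Proof.
by move=> k X Y; elim: u => [//|x u IH]; rewrite !lprod_cons IH linearP.
Qed.
HB.instance Definition _ u :=
  GRing.isLinear.Build K A A *:%R (lprod u) (lprod_is_linear u).

Lemma rprod_is_linear w : linear (rprod w).
Proof.
move=> k X Y; elim: w X Y => [//|x w IH] X Y.
by rewrite !rprod_cons -IH -!/(rmul x.2 _) linearP.
Qed.
HB.instance Definition _ w :=
  GRing.isLinear.Build K A A *:%R (rprod w) (rprod_is_linear w).

Lemma gmul_rprod Y w X : gmul Y (rprod w X) = rprod w (gmul Y X).
Proof. by elim: w X => [//|x w IH] X; rewrite !rprod_cons IH gmulA. Qed.

Lemma gmul_lprod u X Y : gmul (lprod u X) Y = lprod u (gmul X Y).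
Proof. by elim: u => [//|x u IH]; rewrite !lprod_cons -gmulA IH. Qed.

Lemma gmul_rprod_lprod w X Y : gmul (rprod w X) Y = gmul X (lprod w Y).
Proof. by elim: w X => [//|x w IH] X; rewrite rprod_cons IH -gmulA. Qed.

Lemma lprod_rprod u w X : lprod u (rprod w X) = rprod w (lprod u X).
Proof. by elim: u => [//|x u IH]; rewrite !lprod_cons IH gmul_rprod. Qed.

Lemma lprod_letter_linear u p w X : linear (fun b => lprod (u ++ (p, b) :: w) X).
Proof.
move=> k a b; rewrite !lprod_cat !lprod_cons /= -linearP; congr lprod.
by rewrite -!/(rmul _ _) linearP.
Qed.

Lemma rprod_letter_linear u p w X : linear (fun b => rprod (u ++ (p, b) :: w) X).
Proof. by move=> k a b; rewrite !rprod_cat !rprod_cons /= !linearP. Qed.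

Lemma homogeneousZ p k (a : A) : homogeneous p a -> homogeneous p (k *: a).
Proof. by rewrite /homogeneous linearZ => ->. Qed.

Lemma homogeneous_sum I (r : seq I) (P : pred I) (F : I -> A) p :
  (forall i, P i -> homogeneous p (F i)) ->
  homogeneous p (\sum_(i <- r | P i) F i).
Proof.
by move=> hF; rewrite /homogeneous linear_sum; apply: eq_bigr => i /hF.
Qed.

Definition hom_word w : Prop := forall x, x \in w -> homogeneous x.1 x.2.

Lemma hom_word_cons x w :
  hom_word (x :: w) -> homogeneous x.1 x.2 /\ hom_word w.
Proof.
by move=> hw; split=> [|y yw]; apply: hw; rewrite inE ?eqxx ?yw ?orbT.
Qed.

Lemma hom_word_cat u v : hom_word (u ++ v) <-> hom_word u /\ hom_word v.
Proof.
split=> [h|[hu hv] x]; last by rewrite mem_cat => /orP[/hu|/hv].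
by split=> x xu; apply: h; rewrite mem_cat xu ?orbT.
Qed.

Lemma homogeneous_lprod u X p : hom_word u -> homogeneous p X ->
  homogeneous (p (+) wpar eps u) (lprod u X).
Proof.
move=> hu hX; elim: u hu => [|x u IH] hu; first by rewrite wpar_nil addbF.
have [hx /IH hl] := hom_word_cons hu.
rewrite lprod_cons wpar_cons; have := gmul_parity hx hl.
by congr homogeneous; rewrite addbAC addbCA -!addbA.
Qed.

Lemma homogeneous_rprod w X p : hom_word w -> homogeneous p X ->
  homogeneous (p (+) wpar eps w) (rprod w X).
Proof.
elim: w X p => [|x w IH] X p hw hX; first by rewrite wpar_nil addbF.
have [hx hw'] := hom_word_cons hw.
rewrite rprod_cons wpar_cons; have := IH _ _ hw' (gmul_parity hX hx).
by congr homogeneous; rewrite -!addbA.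
Qed.

End Products.

(** * The relations on ordered words *)

Section AInfinity.
Variables (K : numFieldType) (eps : bool) (A : gradedAlgebra K eps).
Variables (e : A) (D : {linear A -> A}).
Implicit Types (a b u v w y : seq (bool * A)).

Local Notation sgn w := ((-1) ^+ wpar eps w).
Local Notation egfB := (@egfB K).
Local Notation exp_ddiff := (@exp_ddiff K).

(* The Koszul bracket without its sum over permutations. *)
Definition ordered_bracket v : A :=
  cut3 (fun u m w => (egfB (size u) (size w) / (size m)`!%:R * sgn u) *:
                       rprod w (lprod u (D (lprod m e)))) v.
Local Notation E := ordered_bracket.

(** The recorded parity is that of [E y]: the suspended parity of [y], plus [eps] from [e] and one
    from Delta. *)
Definition bracket_letter y : bool * A := (~~ (eps (+) wpar eps y), E y).

Lemma wpar_bracket_letter a y b :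
  wpar eps (a ++ bracket_letter y :: b)
  = ~~ (wpar eps a (+) wpar eps y (+) wpar eps b).
Proof.
rewrite wpar_cat wpar_cons /bracket_letter /=.
by move: (wpar _ a) (wpar _ y) (wpar _ b); clear; case: eps => [] [] [] [].
Qed.

(** The weight 1/(|a| + |b| + 1)! of a E(y) b is that of the derivative of the exponential series in
    the direction E. *)
Definition dexp_bracket v : A :=
  cut3 (fun a y b => (sgn a * exp_ddiff (size a) (size b)) *:
                       rprod b (lprod a (E y))) v.

(* With x a formal even argument this reads dexp_x (E x) = D (e^x e): the
   generating series of B is the inverse of (e^x - e^y) / (x - y). *)
Lemma dexp_bracketE v : dexp_bracket v = (size v)`!%:R^-1 *: D (lprod v e).
Proof.
transitivity (cut3 (fun a y b => cut3 (fun u m w =>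
    (egfB (size u) (size w) * exp_ddiff (size a) (size b)) *:
      ((sgn (a ++ u) / (size m)`!%:R) *:
        rprod (w ++ b) (lprod (a ++ u) (D (lprod m e))))) y) v).
  apply: eq_cut3 => a y b _; rewrite !raddf_cut3 /=.
  apply: eq_cut3 => u m w _; rewrite !linearZ /= !scalerA lprod_cat rprod_cat.
  rewrite lprod_rprod wpar_cat signr_addb; congr (_ *: _); ring.
(* Grouping the pieces as (a u) m (w b) makes the weights a product of mutually inverse series, so
   only empty outer words survive. *)
rewrite (cut3_cut3 (fun a u m w b =>
    (egfB (size u) (size w) * exp_ddiff (size a) (size b)) *:
      ((sgn (a ++ u) / (size m)`!%:R) *:
        rprod (w ++ b) (lprod (a ++ u) (D (lprod m e)))))).
transitivity (cut3 (fun x m y => ((size x == 0) && (size y == 0))%:R *: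
      ((sgn x / (size m)`!%:R) *: rprod y (lprod x (D (lprod m e))))) v).
  apply: eq_cut3 => x m y _; rewrite -cut_egfB_exp_ddiff -cut_scalel.
  apply: eq_cut => a u ->; rewrite -cut_scalel.
  by apply: eq_cut => w b ->.
rewrite cut3_id => [|a y b _]; first by rewrite wpar_nil !scale1r mul1r.
by case: a b => [|? ?] [|? ?] //= _; rewrite ?andbF scale0r.
Qed.

(* For c = 1 the vanishing of this is the A_infinity relation for E. *)
Definition bracket_square (c : nat -> nat -> K) v : A :=
  cut3 (fun a y b => (c (size v) (size y) * sgn a) *:
                       E (a ++ bracket_letter y :: b)) v.

Hypothesis D_nilpotent : forall b : A, D (gmul (D b) e) = 0.

(* Apply dexp_bracketE to words in which a subword y is replaced by the letter
   E y. The letter inside E gives the claim; the two ways of having it outside,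
   left or right, cancel because two odd letters are exchanged. *)
Lemma dexp_bracket_square v :
  cut3 (fun a t b => exp_ddiff (size a) (size b) *:
          rprod b (lprod a (bracket_square (fun _ _ => 1) t))) v = 0.
Proof.
(* By [dexp_bracketE] on each word with an inserted letter, this sum is D applied to
   ([dexp_bracket v]) e. By [dexp_bracketE] on [v] it is a multiple of D (D (...) e), hence 0. *)
have <- : cut3 (fun a y b =>
    sgn a *: dexp_bracket (a ++ bracket_letter y :: b)) v = 0.
  transitivity (D (rmul e (dexp_bracket v))); last first.
    by rewrite dexp_bracketE !linearZ /= /rmul D_nilpotent scaler0.
  rewrite !raddf_cut3; apply: eq_cut3 => a y b _.
  rewrite dexp_bracketE scalerA /= (linearZ_LR (rmul e)) (linearZ_LR D) /=.
  congr (_ * _ *: D _); first by rewrite size_cat addnS.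
  by rewrite lprod_cat lprod_cons /rmul gmul_rprod_lprod gmul_lprod.
(* The common shape a E(y) p E(q) r of the terms in which neither bracket value lies inside the
   other. *)
symmetry; pose f a y p q r := (sgn a * sgn (a ++ y ++ p) *
    exp_ddiff (size a) (size p + (size r).+1)) *:
      rprod r (lprod a (gmul (E y) (lprod p (E q)))).
under eq_cut3 => a y b _ do rewrite /dexp_bracket cut3_cat_cons !scalerDr.
rewrite !cut3D.
have -> : cut3 (fun a y b => sgn a *: cut3 (fun p q r =>
      (sgn p * exp_ddiff (size p) (size (r ++ bracket_letter y :: b))) *:
        rprod (r ++ bracket_letter y :: b) (lprod p (E q))) a) v
    = cut3 (fun a y x => cut3 (f a y) x) v.
  rewrite -(cut3_cutl f); apply: eq_cut3 => x d b _.
  rewrite raddf_cut3; apply: eq_cut3 => a y p -> /=.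
  rewrite /f scalerA mulrA size_cat rprod_cat rprod_cons /= -gmul_lprod.
  by rewrite -gmul_rprod_lprod mulrAC [sgn a * _]mulrC mulrAC.
(* Here the prefix contains the inserted letter, whose suspended parity is opposite to that of [y];
   hence the minus sign. *)
have -> : cut3 (fun a y b => sgn a *: cut3 (fun p q r =>
      (sgn (a ++ bracket_letter y :: p) *
        exp_ddiff (size (a ++ bracket_letter y :: p)) (size r)) *:
        rprod r (lprod (a ++ bracket_letter y :: p) (E q))) b) v
    = - cut3 (fun a y x => cut3 (f a y) x) v.
  rewrite raddf_cut3; apply: eq_cut3 => a y b _.
  rewrite raddf_cut3 [RHS]raddf_cut3; apply: eq_cut3 => p q r _ /=.
  rewrite /f -scaleNr scalerA mulrA lprod_cat lprod_cons -mulNr -mulrN.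
  congr (_ * _ * _ *: _); last first.
    by rewrite size_cat /= /exp_ddiff; congr (_`!%:R^-1); lia.
  by rewrite wpar_bracket_letter !wpar_cat addbA signrN.
rewrite addrAC subrr add0r; symmetry.
transitivity (cut3 (fun a t b => cut3 (fun p y q =>
    (exp_ddiff (size a) (size b) * sgn p) *:
       rprod b (lprod a (E (p ++ bracket_letter y :: q)))) t) v).
  apply: eq_cut3 => a t b _; rewrite /bracket_square !raddf_cut3.
  apply: eq_cut3 => p y q _ /=.
  by rewrite mul1r (linearZ_LR (lprod a)) (linearZ_LR (rprod b)) /= scalerA.
apply: etrans (cut3_cut3 (fun a p y q b =>
  (exp_ddiff (size a) (size b) * sgn p) *:
     rprod b (lprod a (E (p ++ bracket_letter y :: q)))) v) _.
apply: eq_cut3 => a y b _; rewrite raddf_cut; apply: eq_cut => p q ->.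
rewrite raddf_cut; apply: eq_cut => r s _ /=.
rewrite scalerA wpar_cat signr_addb; congr (_ *: _).
by rewrite mulrCA !mulrA -expr2 sqrr_sign mul1r mulrC.
Qed.

(** The preceding relation is unitriangular in word length: the term with empty outer pieces is the
    claim, and all others involve shorter words. *)
Lemma bracket_square1_eq0 v : bracket_square (fun _ _ => 1) v = 0.
Proof.
have [n] := ubnP (size v); elim: n v => // n IH v le_v.
have := dexp_bracket_square v; rewrite cut3_id => [|a t b def_v lt0].
  by rewrite /exp_ddiff /= invr1 scale1r.
rewrite IH ?linear0 ?scaler0 //.
by move: le_v lt0; rewrite def_v !size_cat; lia.
Qed.

End AInfinity.

(** * Koszul brackets and their bracket product *)

Lemma sum_ord_compl (V : nmodType) (n m : nat) (F : nat -> V) :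
  \sum_(k < n.+1 | (m + k)%N == n) F k = if (m <= n)%N then F (n - m)%N else 0.
Proof.
case: leqP => [le_mn|lt_nm]; last first.
  by rewrite big_pred0 // => k; apply/eqP; lia.
have lt_n : (n - m < n.+1)%N by rewrite ltnS leq_subr.
rewrite (big_pred1 (Ordinal lt_n)) // => k.
by rewrite /= -val_eqE /=; apply/eqP/eqP; lia.
Qed.

Lemma symm_exchange (K : numFieldType) (eps : bool) (A V : lmodType K)
    (F : seq (bool * A) -> seq (bool * A) -> V) y z :
  symm eps (fun y => symm eps (F y) z) y
  = symm eps (fun z => symm eps (F^~ z) y) z.
Proof.
rewrite /symm; under eq_bigr => s _ do rewrite scaler_sumr.
rewrite exchange_big; apply: eq_bigr => t _; rewrite scaler_sumr.
by apply: eq_bigr => s _; rewrite !scalerA mulrC.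
Qed.

Lemma linear_symm (K : numFieldType) (eps : bool) (A V W : lmodType K)
    (h : V -> W) (F : seq (bool * A) -> V) w : linear h ->
  h (symm eps F w) = symm eps (h \o F) w.
Proof.
move=> hP; pose mh := GRing.isLinear.Build K V W *:%R h hP.
pose H : {linear V -> W} := HB.pack h mh.
rewrite -[h]/(H : V -> W) /symm linear_sum.
by apply: eq_bigr => s _; rewrite linearZ.
Qed.

Lemma wpar_perm (K : numFieldType) (eps : bool) (A : lmodType K)
    (v w : seq (bool * A)) : perm_eq v w -> wpar eps v = wpar eps w.
Proof. exact: perm_big. Qed.

Section KoszulBracket.
Variables (K : numFieldType) (eps : bool) (A : gradedAlgebra K eps).
Variables (e : A) (D : {linear A -> A}).
Implicit Types (a b u v w y z : seq (bool * A)).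

Local Notation sgn w := ((-1) ^+ wpar eps w).
Local Notation E := (ordered_bracket e D).
Local Notation KB := (koszul_bracket_hom e D).

Lemma sign_word u :
  (-1) ^+ (\sum_(x <- u) (x.1 : nat) + size u * eps)%N = sgn u :> K.
Proof.
elim: u => [|x u IH]; first by rewrite big_nil wpar_nil.
rewrite big_cons /= wpar_cons signr_addb -IH mulSn addnACA exprD.
by rewrite exprD -signr_addb.
Qed.

(** With the sum over permutations outermost, the triples i + j + k = n are the splittings of the
    permuted word into three pieces. *)
Lemma koszul_bracket_symm w : KB w = symm eps E w.
Proof.
pose G i j k v := (koszulB K i k / (i`! * j`! * k`!)%:R *
    (-1) ^+ (\sum_(x <- take i v) (x.1 : nat) + i * eps)%N) *:
  sandwich e D [seq x.2 | x <- take i v] [seq x.2 | x <- take j (drop i v)]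
     [seq x.2 | x <- drop (i + j) v].
rewrite /koszul_bracket_hom; set n := size w.
transitivity (symm eps (fun v => \sum_(i < n.+1) \sum_(j < n.+1)
    \sum_(k < n.+1 | (i + j + k)%N == n) G i j k v) w).
  rewrite symm_sum; apply: eq_bigr => i _; rewrite symm_sum.
  apply: eq_bigr => j _; rewrite symm_sum; apply: eq_bigr => k _.
  rewrite scaler_sumr; apply: eq_bigr => s _.
  by rewrite !scalerA -addnA exprD mulrCA.
apply: eq_symm => v /perm_size sv; rewrite -/n in sv.
rewrite /ordered_bracket /cut3 /cut sv; apply: eq_bigr => i _.
rewrite size_drop sv.
under eq_bigr => j _ do rewrite (sum_ord_compl n (i + j) (fun k => G i j k v)).
rewrite -big_mkcond /=.
rewrite (big_ord_widen n.+1 (fun j => (egfB K (size (take i v))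
    (size (drop j (drop i v))) / (size (take j (drop i v)))`!%:R *
    sgn (take i v)) *: rprod (drop j (drop i v)) (lprod (take i v)
      (D (lprod (take j (drop i v)) e))))); last by lia.
apply: eq_big => j; first by have := ltn_ord i; lia.
move=> le_ij; have le_i : (i <= n)%N by rewrite -ltnS.
have le_j : (j <= n - i)%N by lia.
rewrite !size_drop !size_takel ?size_drop ?sv // /G subnDA; congr (_ *: _).
  rewrite -sign_word size_takel ?sv //; congr (_ * _).
  rewrite /egfB /egf2 !natrM; field.
  by rewrite !pnatr_eq0 -!lt0n !fact_gt0.
by rewrite drop_drop addnC.
Qed.

Lemma ordered_bracket_letter_linear u p w : linear (fun X : A => E (u ++ (p, X) :: w)).
Proof.
move=> k X Y; rewrite /ordered_bracket !cut3_cat_cons !scalerDr.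
rewrite [RHS]addrACA [X in _ = X + _]addrACA; congr (_ + _ + _).
- rewrite raddf_cut3 -cut3D; apply: eq_cut3 => a b c _ /=.
  rewrite rprod_letter_linear !size_cat /= scalerDr !scalerA.
  by congr (_ *: _ + _); rewrite mulrC.
- rewrite raddf_cut -cutD; apply: eq_cut => a b _ /=.
  rewrite raddf_cut -cutD; apply: eq_cut => c d _ /=.
  by rewrite lprod_letter_linear !size_cat /= !linearP.
- rewrite raddf_cut3 -cut3D; apply: eq_cut3 => a b c _ /=.
  rewrite lprod_letter_linear !size_cat /= linearP scalerDr !scalerA.
  by rewrite !wpar_cat !wpar_cons; congr (_ *: _ + _); rewrite mulrC.
Qed.

Lemma ordered_bracket_letter0 p w : (p, 0) \in w -> E w = 0.
Proof.
case/splitPr => u v; have := ordered_bracket_letter_linear u p v (-1) 0 0.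
by rewrite scaler0 addr0 scaleN1r addNr.
Qed.

Lemma symm_letter0 (V : lmodType K) (F : seq (bool * A) -> V) p w :
  (forall v, (p, 0) \in v -> F v = 0) -> (p, 0) \in w -> symm eps F w = 0.
Proof.
move=> F0 p0w; rewrite (@eq_symm _ eps _ _ _ (fun=> 0)) => [|v /perm_mem eq_vw].
  by rewrite /symm big1 // => s _; rewrite scaler0.
by apply: F0; rewrite eq_vw.
Qed.

Lemma koszul_bracket_letter0 p w : (p, 0) \in w -> KB w = 0.
Proof.
rewrite koszul_bracket_symm; apply: symm_letter0.
exact: ordered_bracket_letter0.
Qed.

Lemma bracket_square_letter0 (c : nat -> nat -> K) p w :
  (p, 0) \in w -> bracket_square e D c w = 0.
Proof.
move=> p0w; apply: cut3_eq0 => a y b def_w.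
move: p0w; rewrite def_w !mem_cat => p0; have [p0y | p0y] := boolP ((p, 0) \in y).
  rewrite /bracket_letter (ordered_bracket_letter0 p0y).
  rewrite (@ordered_bracket_letter0 (~~ (eps (+) wpar eps y))) ?scaler0 //.
  by rewrite mem_cat inE eqxx orbT.
rewrite (@ordered_bracket_letter0 p) ?scaler0 // mem_cat inE.
by case/orP: p0 => [->|]; rewrite ?(negbTE p0y) //= => ->; rewrite !orbT.
Qed.

(** Any choice of parities other than the recorded one projects some argument to 0. *)
Lemma multilinear_ext_hom (F : seq (bool * A) -> A) w :
  (forall p v, (p, 0) \in v -> F v = 0) -> hom_word w ->
  multilinear_ext F [seq x.2 | x <- w] = F w.
Proof.
move=> F0 hom_w; rewrite /multilinear_ext.
have sw : size [seq x.1 | x <- w] == size [seq x.2 | x <- w].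
  by rewrite !size_map.
rewrite (bigD1 (Tuple sw)) //= [X in _ + X]big1 ?addr0 => [|p neq_p].
  congr F; elim: w hom_w {sw} => //= x w IH /hom_word_cons[hx /IH ->].
  by rewrite hx -surjective_pairing.
have {neq_p} : (p : seq bool) != [seq x.1 | x <- w] by [].
have : size p = size w by rewrite size_tuple size_map.
move: (p : seq bool) => q sq neq_q.
suff /hasP[x xv /eqP x0] : has (fun x => x.2 == 0)
    [seq (x.1, gpart x.1 x.2) | x <- zip q [seq x.2 | x <- w]].
  by apply: (F0 x.1); rewrite -x0 -surjective_pairing.
elim: q w sq neq_q hom_w {p sw} => [|p q IH] [|x w] //= [sq] neq_q.
case/hom_word_cons => hx hom_w; rewrite eqseq_cons negb_and in neq_q.
have [eq_px|neq_px] := eqVneq p x.1; last first.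
  by rewrite -hx gpartK (negbTE neq_px) eqxx.
by rewrite (IH w) ?orbT //; move: neq_q; rewrite eq_px eqxx.
Qed.

Lemma koszul_bracketE w : hom_word w ->
  koszul_bracket e D [seq x.2 | x <- w] = KB w.
Proof. exact: multilinear_ext_hom koszul_bracket_letter0. Qed.

Hypothesis e_hom : homogeneous eps e.
Hypothesis D_odd : grassmann_odd D.

Lemma homogeneous_cut (f : seq (bool * A) -> seq (bool * A) -> A) p w :
  (forall u v, w = u ++ v -> homogeneous p (f u v)) -> homogeneous p (cut f w).
Proof.
by move=> hf; apply: homogeneous_sum => i _; apply: hf; rewrite cat_take_drop.
Qed.

Lemma homogeneous_ordered_bracket w : hom_word w ->
  homogeneous (~~ (eps (+) wpar eps w)) (E w).
Proof.
move=> hom_w; apply: homogeneous_cut => u t def_w.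
apply: homogeneous_cut => m v def_t.
move: hom_w; rewrite def_w def_t => /hom_word_cat[hu /hom_word_cat[hm hv]].
apply: homogeneousZ.
have := homogeneous_rprod hv
  (homogeneous_lprod hu (D_odd (homogeneous_lprod hm e_hom))).
congr homogeneous; rewrite !wpar_cat.
by move: (wpar _ u) (wpar _ m) (wpar _ v); case: (eps) => [] [] [] [].
Qed.

Lemma hom_word_perm v w : perm_eq v w -> hom_word w -> hom_word v.
Proof. by move=> /perm_mem eq_vw hw x; rewrite eq_vw => /hw. Qed.

Lemma homogeneous_koszul_bracket w : hom_word w ->
  homogeneous (~~ (eps (+) wpar eps w)) (KB w).
Proof.
move=> hom_w; rewrite koszul_bracket_symm.
have gpart_lin p : linear (@gpart K A p) by exact: linearP.
rewrite /homogeneous (linear_symm _ _ _ (gpart_lin _)).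
apply: eq_symm => v eq_vw /=; rewrite -(wpar_perm eps eq_vw).
exact: homogeneous_ordered_bracket (hom_word_perm eq_vw hom_w).
Qed.

(** The inner value enters as a first letter: [symm_cons] places it at every position of [z], and
    linearity in this letter extracts the inner symmetrization. *)
Lemma koszul_bracket_nested y z : hom_word y -> hom_word z ->
  koszul_bracket e D (koszul_bracket e D [seq x.2 | x <- y] :: [seq x.2 | x <- z])
  = \sum_(r < (size z).+1) symm eps (fun y => symm eps (fun z =>
      (-1) ^+ (~~ wpar eps y && wpar eps (take r z)) *:
      E (take r z ++ bracket_letter e D y :: drop r z)) z) y.
Proof.
move=> hom_y hom_z; rewrite koszul_bracketE //; pose p := ~~ (eps (+) wpar eps y).
rewrite -[_ :: _]/[seq x.2 | x <- (p, KB y) :: z] koszul_bracketE; last first.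
  move=> x; rewrite inE => /orP[/eqP -> | /hom_z //].
  exact: homogeneous_koszul_bracket.
rewrite koszul_bracket_symm symm_cons; apply: eq_bigr => r _.
rewrite symm_exchange; apply: eq_symm => z' _ /=.
rewrite koszul_bracket_symm.
rewrite (linear_symm _ _ _ (ordered_bracket_letter_linear (take r z') p (drop r z'))).
rewrite -symmZ; apply: eq_symm => v eq_vy /=.
rewrite /bracket_letter (wpar_perm eps eq_vy) -/p; congr (_ ^+ _ *: _).
by rewrite /p addbC -addbN addbA addbb.
Qed.

(** [symm_block] merges the nested symmetrizations, and [symm_swap] returns the inner arguments to
    the place where their bracket value stands. *)
Lemma bracket_product_symm (c : nat -> nat -> K) w : hom_word w ->
  let Phi := koszul_bracket e D in
  \sum_(k < (size w).+1) (c (size w) k / (k`! * (size w - k)`!)%:R) *: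
    \sum_(pi : 'S_(size w))
      (-1) ^+ word_sign eps pi *:
         Phi (Phi (take k [seq x.2 | x <- permute_word pi])
                :: drop k [seq x.2 | x <- permute_word pi])
  = symm eps (bracket_square e D c) w.
Proof.
move=> hom_w Phi; set n := size w.
pose G k r v := (c n k * sgn (take r v)) *:
  E (take r v ++ bracket_letter e D (take k (drop r v)) :: drop k (drop r v)).
transitivity (\sum_(k < n.+1) \sum_(r < (n - k).+1) symm eps (G k r) w).
  apply: eq_bigr => k _; have le_k : (k <= n)%N by rewrite -ltnS.
  transitivity ((c n k / (k`! * (n - k)`!)%:R) *: symm eps (fun v =>
     \sum_(r < (n - k).+1) symm eps (fun y => symm eps (fun z =>
      (-1) ^+ (~~ wpar eps y && wpar eps (take r z)) *:
      E (take r z ++ bracket_letter e D y :: drop r z)) (drop k v)) (take k v)) w).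
    congr (_ *: _); apply: (@eq_symm _ eps A A (fun v =>
      Phi (Phi (take k [seq x.2 | x <- v]) :: drop k [seq x.2 | x <- v]))).
    move=> v eq_vw; rewrite -map_take -map_drop.
    have := hom_word_perm eq_vw hom_w; rewrite -{1}(cat_take_drop k v).
    case/hom_word_cat => hom_y hom_z; rewrite /Phi koszul_bracket_nested //.
    by rewrite size_drop (perm_size eq_vw).
  rewrite symm_sum scaler_sumr; apply: eq_bigr => r _.
  have le_r : (k + r <= n)%N by have := ltn_ord r; lia.
  rewrite symm_block // scalerA divfK; last first.
    by rewrite pnatr_eq0 -lt0n muln_gt0 !fact_gt0.
  rewrite -symmZ -(symm_swap eps (G k r) le_r); apply: eq_symm => v /perm_size sv.
  rewrite -/n in sv.
  have s1 : size (take r (drop k v)) = r by rewrite size_takel // size_drop sv; lia.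
  have s2 : size (take k v) = k by rewrite size_takel // sv.
  rewrite /G take_size_cat // drop_size_cat // take_size_cat // drop_size_cat //.
  (* Moving the bracket value past the [r] letters and moving its arguments past them differ by the
     sign of these letters, since the bracket is odd. *)
  rewrite !scalerA mulrCA -signr_addb; congr (_ * _ ^+ _ *: _).
  by case: (wpar eps (take k v)); case: (wpar _ _).
rewrite (sum_triangle_exchange n (fun k r => symm eps (G k r) w)).
under eq_bigr => r _ do rewrite -symm_sum.
rewrite -symm_sum; apply: eq_symm => v /perm_size sv; rewrite -/n in sv.
rewrite /bracket_square /cut3 /cut sv; apply: eq_bigr => r _.
rewrite size_drop sv; apply: eq_bigr => k _.
by rewrite /G size_takel // size_drop sv -ltnS.
Qed.

Lemma bracket_product_koszul (c : nat -> nat -> K) (s : seq A) :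
  bracket_product c (koszul_bracket e D) (koszul_bracket e D) s
  = multilinear_ext (symm eps (bracket_square e D c)) s.
Proof.
apply: eq_bigr => p _; apply: bracket_product_symm => x /mapP[y _ ->] /=.
by rewrite /homogeneous gpartK eqxx.
Qed.

Lemma bracket_product_koszul_eq0 (c : nat -> nat -> K) :
  (forall X : A, D (gmul (D X) e) = 0) ->
  (exists c' : nat -> K, forall n k : nat, (k <= n)%N -> c n k = c' n) ->
  forall s : seq A,
    bracket_product c (koszul_bracket e D) (koszul_bracket e D) s = 0.
Proof.
move=> D_nil [c' cE] s; rewrite bracket_product_koszul.
apply: big1 => p _; apply: big1 => t _.
set v := permute_word t.
suff -> : bracket_square e D c v = 0 by rewrite scaler0.
transitivity (c' (size v) *: bracket_square e D (fun _ _ => 1) v); last first.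
  by rewrite bracket_square1_eq0 ?scaler0.
rewrite [RHS]raddf_cut3; apply: eq_cut3 => a y b def_v /=.
by rewrite mul1r scalerA cE // def_v !size_cat; lia.
Qed.

End KoszulBracket.

(** * The example K[a, theta] *)

Lemma cut3_size (T : Type) (V : nmodType) (f : nat -> nat -> nat -> V)
    (v : seq T) :
  cut3 (fun a b c => f (size a) (size b) (size c)) v
  = \sum_(i < (size v).+1) \sum_(j < (size v - i).+1) f i j (size v - i - j)%N.
Proof.
rewrite -(cut_size (fun i m => \sum_(j < m.+1) f i j (m - j)%N)).
by apply: eq_cut => a t _; rewrite (cut_size (f (size a))).
Qed.

Lemma cut3_mid (T : Type) (V : nmodType) (h : nat -> nat -> V) m (v : seq T) :
  cut3 (fun a b c => if size b == m then h (size a) (size c) else 0) v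
  = if (m <= size v)%N
    then \sum_(i < (size v - m).+1) h i (size v - m - i)%N else 0.
Proof.
rewrite (cut3_size (fun i j k => if j == m then h i k else 0)).
rewrite (sum_triangle_exchange (size v)
  (fun i j => if j == m then h i (size v - i - j)%N else 0)).
case: leqP => [le_mv | lt_vm]; last first.
  apply: big1 => j _; apply: big1 => i _.
  by have /negbTE-> : nat_of_ord j != m by have := ltn_ord j; lia.
have lt_m : (m < (size v).+1)%N by [].
rewrite (bigD1 (Ordinal lt_m)) //= [X in _ + X]big1 ?addr0 => [|j neq_jm].
  by apply: eq_bigr => i _; rewrite eqxx subnAC.
by apply: big1 => i _; rewrite ifN.
Qed.

(** Letters of parity [eps] are even after suspension, so all n! permutations contribute the same
    term without sign. *)
Lemma symm_nseq (K : numFieldType) (eps : bool) (A V : lmodType K)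
    (F : seq (bool * A) -> V) n a :
  symm eps F (nseq n (eps, a)) = n`!%:R *: F (nseq n (eps, a)).
Proof.
set w := nseq _ _; have sw : size w = n by rewrite size_nseq.
rewrite (@eq_symm _ _ _ _ _ (fun=> F w)) => [|v eq_vw].
  rewrite (symmE _ _ sw) (eq_bigr (fun=> F w)) => [|pi _].
    by rewrite sumr_const card_Sn scaler_nat.
  rewrite /rsign /koszul_sign big1 ?scale1r // => i _; rewrite big1 // => j _.
  by rewrite !nth_nseq !ltn_ord /= addbb.
congr F; rewrite /w -sw -(perm_size eq_vw); apply/all_pred1P/allP => x.
by rewrite (perm_mem eq_vw) mem_nseq => /andP[_].
Qed.

Section Example.
Variables (K : numFieldType) (i0 : nat).

Let P := ({poly K} * {poly K})%type.

(* The pair (f, g) stands for f + g theta in K[a, theta], theta odd. *)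
Definition dual_part (p : bool) (x : P) : P := if p then (0, x.2) else (x.1, 0).

Lemma dual_part_linear p : linear (dual_part p).
Proof.
by move=> k x y; apply/eqP; case: p;
  rewrite xpair_eqE /= ?eqxx ?andbT /= scaler0 addr0.
Qed.
HB.instance Definition _ p :=
  GRing.isLinear.Build K P P *:%R (dual_part p) (dual_part_linear p).

Lemma dual_partK p q x :
  dual_part p (dual_part q x) = if p == q then dual_part q x else 0.
Proof. by case: p q => [] []. Qed.

Lemma dual_part_sum x : dual_part false x + dual_part true x = x.
Proof. by case: x => f g; congr (_, _); rewrite /= ?addr0 ?add0r. Qed.

Definition dual_space : gradedSpace K := GradedSpace dual_partK dual_part_sum.

Definition dual_mul (x y : dual_space) : dual_space := (x.1 * y.1, x.1 * y.2 + x.2 * y.1).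

Lemma dual_mul_linearr (x : dual_space) : linear (dual_mul x).
Proof.
move=> k y z; congr (_, _) => /=; rewrite !mulrDr -!scalerAr //.
by rewrite scalerDr addrACA.
Qed.

Lemma dual_mulC : commutative dual_mul.
Proof. by move=> x y; congr (_, _); rewrite mulrC // addrC ![_.2 * _]mulrC. Qed.

Lemma dual_mul_linearl (y : dual_space) : linear (dual_mul^~ y).
Proof. by move=> k x z; rewrite !(dual_mulC _ y) dual_mul_linearr. Qed.

Lemma dual_mulA : associative dual_mul.
Proof. by move=> x y z; congr (_, _) => /=; ring. Qed.

Lemma dual_mul_parity (p q : bool) (x y : dual_space) :
  homogeneous p x -> homogeneous q y ->
  homogeneous (p (+) q (+) false) (dual_mul x y : dual_space).
Proof.
move=> <- <-; rewrite /homogeneous /= /dual_mul /dual_part.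
by case: p q => [] [] /=; rewrite ?(mul0r, mulr0, addr0, add0r).
Qed.

Definition dual_algebra : gradedAlgebra K false :=
  @GradedAlgebra K false dual_space dual_mul dual_mul_linearr dual_mul_linearl
    dual_mulA dual_mul_parity.

(** The only sign in the commutation rule concerns two odd elements, whose product vanishes because
    theta^2 = 0. *)
Lemma dual_center (x : dual_algebra) : in_center x.
Proof.
move=> p q y <-; rewrite !addbF /= dual_mulC /dual_mul /dual_part.
case: p q => [] [] /=; rewrite ?scale1r //.
by rewrite !(mul0r, mulr0, addr0) scaler0.
Qed.

Definition dual_one : dual_algebra := (1, 0).

Lemma dual_one_hom : homogeneous false dual_one. Proof. by []. Qed.

(* a^i0 |-> theta, a theta |-> a^(i0 + 1), other monomials |-> 0 *)
Definition dual_op (x : dual_algebra) : dual_algebra :=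
  ((x.2)`_1 *: 'X^(i0.+1), ((x.1)`_i0)%:P).

Lemma dual_op_linear : linear dual_op.
Proof.
move=> k x y; congr (_, _) => /=; rewrite coefD coefZ.
  by rewrite scalerDl scalerA.
by rewrite polyCD polyCM mul_polyC.
Qed.
HB.instance Definition _ :=
  GRing.isLinear.Build K dual_algebra dual_algebra *:%R dual_op dual_op_linear.

Lemma dual_op_odd : grassmann_odd dual_op.
Proof.
move=> p x <-; case: p; rewrite /homogeneous /= /dual_part /dual_op /=.
  by rewrite coef0.
by rewrite coef0 scale0r.
Qed.

(** As e = 1, this says Delta^2 = 0: theta has no component along a theta, and a^(i0 + 1) has none
    along a^i0. *)
Lemma dual_op_nilpotent (x : dual_algebra) :
  dual_op (gmul (dual_op x) dual_one) = 0.
Proof.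
rewrite /= /dual_mul /dual_op /= !mulr1 mulr0 add0r coefC /= scale0r.
by rewrite coefZ coefXn ltn_eqF // mulr0.
Qed.

Local Notation A := dual_algebra.
Let E : seq (bool * A) -> A := ordered_bracket dual_one dual_op.
Let B : nat -> nat -> K := @egfB K.
Let dd : nat -> nat -> K := @exp_ddiff K.

Let a1 : bool * A := (false, ('X, 0) : A).
Let theta (f : {poly K}) : A := (0, f).
(** The coefficient in E(a, ..., a) = [lambda k] a^(k - i0) theta on k arguments; the guard keeps
    the truncated subtraction honest. *)
Let lambda (k : nat) : K :=
  if (i0 <= k)%N then egfB_diag K (k - i0) / i0`!%:R else 0.
Let even (f : {poly K}) : A := (f, 0).

(** * Brackets of words in a with at most one multiple of theta *)

Lemma cat_eq_nseq (u v : seq (bool * A)) n :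
  nseq n a1 = u ++ v -> u = nseq (size u) a1 /\ v = nseq (size v) a1.
Proof.
move=> def_uv; have /all_pred1P : all (pred1 a1) (u ++ v).
  by rewrite -def_uv all_nseq /= eqxx orbT.
rewrite size_cat nseqD => /eqP; rewrite eqseq_cat ?size_nseq //.
by case/andP => /eqP-> /eqP->; rewrite !size_nseq.
Qed.

Lemma lprod_nseq k (x : A) :
  lprod (nseq k a1) x = ('X^k * x.1, 'X^k * x.2).
Proof.
elim: k => [|k IH] /=; first by rewrite !mul1r; case: x.
by rewrite lprod_cons IH /= /dual_mul /= mul0r addr0 !mulrA -!exprS.
Qed.

Lemma rprod_nseq k (x : A) :
  rprod (nseq k a1) x = ('X^k * x.1, 'X^k * x.2).
Proof.
elim: k x => [|k IH] x /=; first by rewrite !mul1r; case: x.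
rewrite rprod_cons IH /= /dual_mul /= mulr0 add0r !exprSr.
by congr (_, _); rewrite ?mulrA [_ * 'X]mulrC mulrA ?(mulrC _ 'X).
Qed.

Lemma wpar_nseq k : wpar false (nseq k a1) = false.
Proof. by elim: k => [|k IH]; rewrite ?wpar_nil //= wpar_cons IH. Qed.

Lemma dual_op_lprod_nseq k :
  dual_op (lprod (nseq k a1) dual_one) = theta (k == i0)%:R%:P.
Proof.
by rewrite lprod_nseq /dual_op /theta /= mulr1 mulr0 coef0 scale0r coefXn eq_sym.
Qed.

(** Only middle pieces of length [i0] survive Delta; B is then summed along a diagonal. *)
Lemma ordered_bracket_nseq k :
  E (nseq k a1) = theta (lambda k *: 'X^(k - i0)).
Proof.
pose h i j : A := (B i j / i0`!%:R) *: theta 'X^(i + j).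
transitivity (cut3 (fun u m w => if size m == i0 then h (size u) (size w) else 0)
  (nseq k a1)).
  apply: eq_cut3 => u m w /cat_eq_nseq[-> def_mw].
  have [-> ->] := cat_eq_nseq (esym def_mw).
  rewrite !size_nseq /= dual_op_lprod_nseq lprod_nseq rprod_nseq /= !mulr0.
  rewrite wpar_nseq mulr1; case: eqP => [->|_]; last by rewrite polyC0 !mulr0 scaler0.
  by rewrite mulr1 -exprD addnC.
rewrite cut3_mid size_nseq /lambda; case: leqP => [le_k|_]; last first.
  by rewrite scale0r.
transitivity ((egfB_diag K (k - i0) / i0`!%:R) *: theta 'X^(k - i0)); last first.
  by congr (_, _); rewrite /= scaler0.
rewrite /egfB_diag mulr_suml scaler_suml; apply: eq_bigr => i _.
by rewrite /h subnKC // -ltnS.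
Qed.

Lemma rprod_theta_theta r l q f g :
  rprod (nseq r a1 ++ (q, theta f) :: nseq l a1) (theta g) = 0.
Proof.
rewrite rprod_cat rprod_nseq rprod_cons rprod_nseq /= /dual_mul /=.
by rewrite !(mulr0, mul0r, addr0).
Qed.

Lemma lprod_theta_theta r l q f g :
  lprod (nseq r a1 ++ (q, theta f) :: nseq l a1) (theta g) = 0.
Proof.
rewrite lprod_cat lprod_nseq lprod_cons lprod_nseq /= /dual_mul /=.
by rewrite !(mulr0, mul0r, addr0).
Qed.

(** If theta stays outside Delta, then Delta of a power of a supplies a second theta and the term
    vanishes. So theta lies in the middle piece, of length |q1| + |q2| + 1. *)
Lemma ordered_bracket_theta r l q f :
  E (nseq r a1 ++ (q, theta f) :: nseq l a1)
  = cut (fun p q1 => cut (fun q2 s =>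
      (B (size p) (size s) * dd (size q1) (size q2)) *:
        even (('X^(size q1 + size q2) * f)`_1 *: 'X^(i0.+1 + size p + size s)))
     (nseq l a1)) (nseq r a1).
Proof.
rewrite /E /ordered_bracket cut3_cat_cons.
rewrite [X in X + _ + _]cut3_eq0 => [|a b d /cat_eq_nseq[-> def_bd]]; last first.
  have [-> ->] := cat_eq_nseq (esym def_bd).
  by rewrite /= dual_op_lprod_nseq lprod_nseq /= mulr0 rprod_theta_theta scaler0.
rewrite [X in _ + _ + X]cut3_eq0 => [|a b d /cat_eq_nseq[-> def_bd]]; last first.
  have [-> ->] := cat_eq_nseq (esym def_bd).
  by rewrite /= dual_op_lprod_nseq lprod_theta_theta linear0 scaler0.
rewrite add0r addr0; apply: eq_cut => a b /cat_eq_nseq[-> ->].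
apply: eq_cut => b' d /cat_eq_nseq[-> ->].
rewrite !size_nseq wpar_nseq mulr1 lprod_cat !lprod_nseq lprod_cons !lprod_nseq.
rewrite rprod_nseq /= /dual_mul /dual_op /= size_cat /= !size_nseq addnS.
rewrite !(mulr0, mulr1, addr0, mul0r, add0r) coef0 polyC0 !mulr0.
congr (_ *: (_, _)); rewrite -!scalerAr -!exprD.
by rewrite mulrCA -exprD mulrC; congr (_ *: 'X^_); lia.
Qed.

Lemma coef1_lambda s k :
  ('X^s * (lambda k *: 'X^(k - i0)))`_1
  = if (s + k == i0.+1)%N then lambda k else 0.
Proof.
rewrite -scalerAr -exprD coefZ coefXn /lambda.
case: leqP => [le_k|_]; last by rewrite mul0r if_same.
have -> : (1 == s + (k - i0))%N = (s + k == i0.+1)%N by lia.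
by case: eqP; rewrite ?mulr1 ?mulr0.
Qed.

(** Pieces [y] of length i0 sit at two positions with weight 1/2 each, the piece of length i0 + 1 at
    one with weight 1. Their [lambda] is 1/i0! and -1/i0!; shorter pieces give 0. *)
Lemma lambda_pair_sum (T : Type) (c : nat -> K) (v : seq T) : size v = i0.+1 ->
  cut3 (fun q1 y q2 => c (size y) * dd (size q1) (size q2) * lambda (size y)) v
  = (c i0 - c i0.+1) / i0`!%:R.
Proof.
move=> sv; have egfB0 : egfB_diag K 0 = 1 by rewrite egfB_diagE divr1.
have egfB1 : egfB_diag K 1 = -1 by rewrite egfB_diagE divr1.
transitivity (cut3 (fun q1 y q2 =>
   (if size y == i0 then c i0 / i0`!%:R * dd (size q1) (size q2) else 0)
 + (if size y == i0.+1 then - c i0.+1 / i0`!%:R * dd (size q1) (size q2) else 0)) v).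
  apply: eq_cut3 => q1 y q2 def_v; rewrite /lambda.
  have := congr1 size def_v; rewrite !size_cat sv => sy.
  case: eqP => [->|neq_i0].
    by rewrite leqnn subnn egfB0 ltn_eqF // addr0 div1r mulrAC.
  case: eqP => [->|neq_i1].
    by rewrite leqnSn subSnn egfB1 add0r mulN1r mulrN !mulNr mulrAC.
  have lt_y : (size y < i0)%N by lia.
  by rewrite leqNgt lt_y mulr0 addr0.
rewrite cut3D (cut3_mid (fun i j => c i0 / i0`!%:R * dd i j)).
rewrite (cut3_mid (fun i j => - c i0.+1 / i0`!%:R * dd i j)) sv leqnSn leqnn.
rewrite subnn subSnn !big_ord_recl !big_ord0 /= /dd /exp_ddiff /= !addr0.
rewrite !factS fact0 !muln1 !subn0 !add0n; field.
by rewrite pnatr_eq0 -lt0n fact_gt0.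
Qed.

(** Delta detects only a theta, which forces q1 y q2 to have length i0 + 1; the remaining n - i0 - 1
    letters outside Delta contribute the diagonal of B. *)
Lemma bracket_square_nseq (c : nat -> nat -> K) n : (i0 < n)%N ->
  bracket_square dual_one dual_op c (nseq n a1)
  = (egfB_diag K (n - i0.+1) * ((c n i0 - c n i0.+1) / i0`!%:R)) *: even 'X^n.
Proof.
move=> lt_n; pose k0 := (c n i0 - c n i0.+1) / i0`!%:R; rewrite -/k0.
pose f (p q1 y q2 s : seq (bool * A)) : A :=
  (B (size p) (size s) *
    if size (q1 ++ y ++ q2) == i0.+1
    then c n (size y) * dd (size q1) (size q2) * lambda (size y) else 0)
  *: even 'X^n.
transitivity (cut3 (fun a y b =>
    cut (fun p q1 => cut (fun q2 s => f p q1 y q2 s) b) a) (nseq n a1)).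
  apply: eq_cut3 => a y b def_n; have [-> def_yb] := cat_eq_nseq def_n.
  have [-> ->] := cat_eq_nseq (esym def_yb).
  rewrite /bracket_letter -/E ordered_bracket_nseq ordered_bracket_theta.
  rewrite wpar_nseq mulr1 size_nseq raddf_cut; apply: eq_cut => p q1 def_a.
  rewrite raddf_cut; apply: eq_cut => q2 s def_b /=.
  rewrite coef1_lambda /f !size_cat !size_nseq.
  have := congr1 size def_n; rewrite !size_cat !size_nseq => sn.
  have := congr1 size def_a; rewrite !size_cat !size_nseq => sa.
  have := congr1 size def_b; rewrite !size_cat !size_nseq => sb.
  rewrite [(_ + size q2 + _)%N]addnAC -addnA.
  case: eqP => [eq_mid|_]; last by rewrite !mulr0 !scale0r /even !scaler0.
  have {}eq_mid : (size q1 + (size y + size q2))%N = i0.+1 := eq_mid.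
  have -> : (i0.+1 + size p + size s = n)%N by lia.
  have -> : even (lambda (size y) *: 'X^n) = lambda (size y) *: even 'X^n.
    by congr (_, _); rewrite /= scaler0.
  by rewrite !scalerA; congr (_ *: _); ring.
rewrite -cut3_cut3.
transitivity (cut3 (fun p x s => if size x == i0.+1
    then (B (size p) (size s) * k0) *: even 'X^n else 0) (nseq n a1)).
  apply: eq_cut3 => p x s _; case: eqP => [sx | /eqP/negbTE neq_x].
    rewrite /k0 -(lambda_pair_sum (c n) sx) mul_cut3 -cut3_scalel.
    by apply: eq_cut3 => q1 y q2 def_x; rewrite /f -def_x sx eqxx.
  apply: cut3_eq0 => q1 y q2 def_x.
  by rewrite /f -def_x neq_x mulr0 scale0r.
rewrite (cut3_mid (fun i j => (B i j * k0) *: even 'X^n)) size_nseq lt_n.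
by rewrite /egfB_diag mulr_suml scaler_suml.
Qed.

(** On n copies of a, the relation is a^n times the difference of the two coefficients, up to a
    numerical factor that is nonzero because B(x, x) = e^(-x) has no zero coefficient. *)
Lemma koszul_relations_coef (c : nat -> nat -> K) n : (i0 < n)%N ->
  bracket_product c (koszul_bracket dual_one dual_op)
    (koszul_bracket dual_one dual_op) (nseq n ('X, 0)) = 0 ->
  c n i0 = c n i0.+1.
Proof.
move=> lt_n; rewrite bracket_product_koszul //; last exact: dual_op_odd.
have -> : nseq n (('X, 0) : A) = [seq x.2 | x <- nseq n a1] by rewrite map_nseq.
rewrite multilinear_ext_hom => [|p v|x]; first last.
- by rewrite mem_nseq => /andP[_ /eqP ->].
- by apply: symm_letter0 => ?; apply: bracket_square_letter0.
rewrite symm_nseq bracket_square_nseq // scalerA => /(congr1 fst) /= /eqP.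
have nat_neq0 m : m`!%:R != 0 :> K by rewrite pnatr_eq0 -lt0n fact_gt0.
rewrite scaler_eq0 egfB_diagE !mulf_eq0 !invr_eq0 signr_eq0 !(negbTE (nat_neq0 _)).
by rewrite -size_poly_eq0 size_polyXn !orbF subr_eq0 => /eqP.
Qed.

End Example.

Theorem theorem3p5 (R : realType) (c : nat -> nat -> R[i]) :
  ((forall (eps : bool) (A : gradedAlgebra R[i] eps) (e : A)
           (D : {linear A -> A}),
       homogeneous eps e ->
       grassmann_odd D ->
       (forall b : A, D (gmul (D b) e) = 0) ->
       forall s : seq A,
         bracket_product c (koszul_bracket e D) (koszul_bracket e D) s = 0)
   <->
   (exists c' : nat -> R[i], forall n k : nat, (k <= n)%N -> c n k = c' n))
  /\
  ((forall (eps : bool) (A : gradedAlgebra R[i] eps) (e : A)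
           (D : {linear A -> A}),
       homogeneous eps e ->
       grassmann_odd D ->
       (forall b : A, D (gmul (D b) e) = 0) ->
       (forall a : A, in_center (D a)) ->
       forall s : seq A,
         bracket_product c (koszul_bracket e D) (koszul_bracket e D) s = 0)
   <->
   (exists c' : nat -> R[i], forall n k : nat, (k <= n)%N -> c n k = c' n)).
Proof.
(* Necessity is derived from the data with central image alone and sufficiency holds for all data,
   so each half serves both equivalences. *)
have central_case : (forall (eps : bool) (A : gradedAlgebra R[i] eps) (e : A)
       (D : {linear A -> A}),
     homogeneous eps e -> grassmann_odd D ->
     (forall b : A, D (gmul (D b) e) = 0) ->
     (forall a : A, in_center (D a)) ->
     forall s : seq A,
       bracket_product c (koszul_bracket e D) (koszul_bracket e D) s = 0) ->
   exists c' : nat -> R[i], forall n k : nat, (k <= n)%N -> c n k = c' n.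
  (* The common value is c^n_0; the example with [i0] equal to [k] links c^n_k to c^n_{k+1}. *)
  move=> rel; exists (fun n => c n 0); move=> n; elim=> // k IH lt_kn.
  rewrite -IH ?(ltnW lt_kn) //; apply/esym/(koszul_relations_coef lt_kn)/rel.
  - exact: dual_one_hom.
  - exact: dual_op_odd.
  - exact: dual_op_nilpotent.
  - by move=> a; apply: dual_center.
split; split.
- by move=> rel; apply: central_case => eps A e D he hD hn _; apply: rel.
- by move=> hc eps A e D he hD hn; apply: bracket_product_koszul_eq0.
- exact: central_case.
- by move=> hc eps A e D he hD hn _; apply: bracket_product_koszul_eq0.
Qed.
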